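(* If $M_1\cap\mathbb{P}\neq\varnothing$ and $f\in\bigcap_{Q\in M_1}L^1(Q)$, then $$\hat f_{id}:=\inf\Big\{x\in\mathbb{R}\,\Big|\, f-x\in\bigcap_{Q\in M_1}\overline{K-L^1_+(Q)}^{Q}\Big\}=\sup_{Q\in M_1}E_Q[f].$$
   Context: Setting: $(\Omega,\mathcal{F},(\mathcal{F}_t)_{t\in[0,T]},P)$ is a filtered probability space whose filtration satisfies the usual conditions (right continuity and completeness). $\mathbb{P}$ is the class of probability measures on $\mathcal{F}$ equivalent to $P$. $X=(X_t)_{t\in[0,T]}$ is an $\mathbb{R}^d$-valued càdlàg semimartingale. An $\mathbb{R}^d$-valued predictable process $H$ is called admissible if it is $X$-integrable and there is a constant $c\in\mathbb{R}$ such that for all $t\in[0,T]$, $\int_0^t H_s\cdot dX_s\ge -c$ $P$-a.s. $L^0$ is the space of ($P$-a.s. equivalence classes of) $P$-a.s. finite random variables on $(\Omega,\mathcal{F})$. $K=\{\int_0^T H_s\cdot dX_s \mid H \text{ admissible}\}\subseteq L^0$. $M_1$ is the set of probability measures $Q\ll P$ such that $K\subseteq L^1(Q)$ and $E_Q[g]\le 0$ for all $g\in K$. For $Q\in M_1$, $L^1_+(Q)$ is the cone of $Q$-a.s. nonnegative elements of $L^1(Q)$, $K-L^1_+(Q)=\{g-h: g\in K, h\in L^1_+(Q)\}\subseteq L^1(Q)$, and $\overline{A}^{Q}$ denotes the closure of $A\subseteq L^1(Q)$ in the $L^1(Q)$-norm. The element $f$ is a random variable in $L^0$ that is $Q$-integrable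 for every $Q\in M_1$. Convention: $\inf\varnothing=+\infty$. *)

(* Defs.v *)
From HB Require Import structures.
From mathcomp Require Import all_boot all_order all_algebra.
From mathcomp Require Import all_classical all_reals all_analysis.

Set Implicit Arguments.
Unset Strict Implicit.
Unset Printing Implicit Defensive.
Import Order.TTheory GRing.Theory Num.Theory.
Import numFieldNormedType.Exports.
Local Open Scope classical_set_scope.
Local Open Scope ring_scope.

(* Random variables are real-valued functions on [Omega]; almost sure
   equivalence classes are represented by their members.  A process is a
   function of (time, outcome), of which only the restriction to the times
   in [0, T] is ever relevant. *)

Section Filtration.
Context {R : realType} {disp : measure_display} {Omega : measurableType disp}.
Variables (P : probability Omega R) (T : R) (F : R -> set (set Omega)).

Definition usual_filtration : Prop :=
  [/\ forall t, 0 <= t <= T -> sigma_algebra setT (F t) /\ F t `<=` measurable,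
      forall s t, 0 <= s -> s <= t -> t <= T -> F s `<=` F t,
      forall t, 0 <= t < T -> \bigcap_(s in `]t, T]) F s `<=` F t &
      forall N, P.-negligible N -> F 0 N].

Definition measurable_wrt (G : set (set Omega)) (g : Omega -> R) : Prop :=
  measurable_fun [set: g_sigma_algebraType G] g.

Definition adapted (Y : R -> Omega -> R) : Prop :=
  forall t, 0 <= t <= T -> measurable_wrt (F t) (Y t).

Definition cadlag (Y : R -> Omega -> R) : Prop :=
  forall w,
    (forall t, 0 <= t < T -> Y s w @[s --> t^'+] --> Y t w) /\
    (forall t, 0 < t <= T -> cvg (Y s w @[s --> t^'-])).

Definition martingale (M : R -> Omega -> R) : Prop :=
  [/\ adapted M,
      forall t, 0 <= t <= T -> M t \in Lfun P 1 &
      forall s t A, 0 <= s -> s <= t -> t <= T -> F s A ->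
        (\int[P]_(w in A) (M t w)%:E = \int[P]_(w in A) (M s w)%:E)%E].

(* The value of a stopping time beyond T is irrelevant: [T < tau w] means that
   tau has not occurred on [0, T]. *)
Definition stopping_time (tau : Omega -> R) : Prop :=
  (forall w, 0 <= tau w) /\
  forall t, 0 <= t <= T -> F t [set w | tau w <= t].

(* On the closed horizon [0, T] a localizing sequence has to reach T, not
   merely to converge to it. *)
Definition local_martingale (M : R -> Omega -> R) : Prop :=
  [/\ adapted M, cadlag M &
    exists tau : nat -> Omega -> R,
      [/\ forall n, stopping_time (tau n),
          forall w, nondecreasing_seq (fun n => tau n w),
          {ae P, forall w, exists n, T <= tau n w} &
          forall n, martingale (fun t w => M (Num.min (tau n w) t) w)]].

Definition finite_variation (A : R -> Omega -> R) : Prop :=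
  [/\ adapted A, cadlag A & forall w, bounded_variation 0 T (A^~ w)].

Definition coordinate {d : nat} (X : R -> Omega -> 'rV[R]_d) (i : 'I_d) :
  R -> Omega -> R := fun t w => X t w ord0 i.

Definition semimartingale {d : nat} (X : R -> Omega -> 'rV[R]_d) : Prop :=
  forall i : 'I_d,
    [/\ adapted (coordinate X i), cadlag (coordinate X i) &
      exists M A : R -> Omega -> R,
        [/\ local_martingale M, finite_variation A,
            forall w, M 0 w = 0 /\ A 0 w = 0 &
            forall t w, 0 <= t <= T ->
              coordinate X i t w = coordinate X i 0 w + M t w + A t w]].

Definition predictable_rectangles : set (set (R * Omega)) :=
  [set S | (exists2 A, F 0 A & S = [set 0] `*` A) \/
           (exists s t A, [/\ 0 <= s, s <= t, t <= T, F s A &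
                              S = `]s, t] `*` A])].

Definition predictable {d : nat} (H : R -> Omega -> 'rV[R]_d) : Prop :=
  forall i : 'I_d,
    measurable_fun
      (`[0, T] `*` [set: Omega] :
         set (g_sigma_algebraType predictable_rectangles))
      (fun z => H z.1 z.2 ord0 i).

Record simple_integrand := SimpleIntegrand {
  coef0 : Omega -> R ;
  pieces : nat ;
  left_end : 'I_pieces -> R ;
  right_end : 'I_pieces -> R ;
  coef : 'I_pieces -> Omega -> R ;
  coef0_measurable : measurable_wrt (F 0) coef0 ;
  coef0_bounded : exists C, forall w, `|coef0 w| <= C ;
  ends_ordered : forall k, [/\ 0 <= left_end k, left_end k <= right_end k &
                               right_end k <= T] ;
  coef_measurable : forall k, measurable_wrt (F (left_end k)) (coef k) ;
  coef_bounded : forall k, exists C, forall w, `|coef k w| <= C }.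
Arguments left_end : clear implicits.
Arguments right_end : clear implicits.
Arguments coef : clear implicits.

Definition simple_process (phi : simple_integrand) : R -> Omega -> R :=
  fun t w => coef0 phi w * \1_[set 0] t +
    \sum_k coef phi k w * \1_(`]left_end phi k, right_end phi k]%classic) t.

(* The integral runs over ]0, t]: the value of the integrand at time 0 does not
   contribute. *)
Definition simple_integral (phi : simple_integrand) (Y : R -> Omega -> R) :
    R -> Omega -> R :=
  fun t w => \sum_k coef phi k w *
    (Y (Num.min (right_end phi k) t) w - Y (Num.min (left_end phi k) t) w).

Definition cvg_in_probability (Yn : nat -> Omega -> R) (Y : Omega -> R) : Prop :=
  forall e : R, 0 < e -> P [set w | e <= `|Yn n w - Y w|] @[n --> \oo] --> 0%E.

(* Emery's distance.  For semimartingales, restricting the test integrands to the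
   simple ones among the predictable processes bounded by 1 does not change its
   value. *)
Definition emery_dist (Y Z : R -> Omega -> R) : \bar R :=
  let D := fun t w => Y t w - Z t w in
  let gap := fun phi w =>
    Num.min 1 (`|D 0 w| + `|simple_integral phi D T w|) in
  ereal_sup
    [set 'E_P[gap phi]%E
    | phi in [set phi | forall t w, 0 <= t <= T ->
                          `|simple_process phi t w| <= 1]].

(* [bounded_integral X H Y]: H is bounded predictable and Y is its stochastic
   integral with respect to X.  This is the extension of the elementary integral
   characterized by dominated convergence: by the monotone class theorem, the
   bounded predictable processes are the closure of the simple ones under
   uniformly bounded pointwise limits, along which the integrals converge in
   probability at each time; Y is determined up to indistinguishability. *)
Inductive bounded_integral {d : nat} (X : R -> Omega -> 'rV[R]_d) :
    (R -> Omega -> 'rV[R]_d) -> (R -> Omega -> R) -> Prop :=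
| bounded_integral_simple (phi : 'I_d -> simple_integrand) :
    bounded_integral X
      (fun t w => \row_i simple_process (phi i) t w)
      (fun t w => \sum_i simple_integral (phi i) (coordinate X i) t w)
| bounded_integral_lim (Hn : nat -> R -> Omega -> 'rV[R]_d)
    (Yn : nat -> R -> Omega -> R) (H : R -> Omega -> 'rV[R]_d)
    (Y : R -> Omega -> R) :
    (forall n, bounded_integral X (Hn n) (Yn n)) ->
    (exists C, forall n t w i, 0 <= t <= T -> `|Hn n t w ord0 i| <= C) ->
    (forall t w i, 0 <= t <= T ->
       Hn n t w ord0 i @[n --> \oo] --> H t w ord0 i) ->
    adapted Y -> cadlag Y ->
    (forall t, 0 <= t <= T -> cvg_in_probability (fun n => Yn n t) (Y t)) ->
    bounded_integral X H Y.

(* [stochastic_integral X H Y]: H is X-integrable and Y is the vector stochastic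
   integral of H with respect to X, as the limit in the semimartingale topology
   of integrals of bounded predictable Hn converging pointwise to H.  For an
   X-integrable H the truncations Hn = H 1_{|H| <= n} are such a sequence.
   Conversely, if the integrals of Hn converge in the semimartingale topology
   then (Memin), under some equivalent probability for which the components of
   X are in M^2 + A and along a subsequence, Hn is Cauchy in L^2(M) and L^1(A)
   for the canonical decomposition X = X_0 + M + A; by Fatou its limit there is
   the pointwise limit H, so H is X-integrable with integral lim (Hn . X).  In
   particular Y is determined by H up to indistinguishability. *)
Definition stochastic_integral {d : nat} (X : R -> Omega -> 'rV[R]_d)
    (H : R -> Omega -> 'rV[R]_d) (Y : R -> Omega -> R) : Prop :=
  [/\ adapted Y, cadlag Y &
    exists (Hn : nat -> R -> Omega -> 'rV[R]_d) (Yn : nat -> R -> Omega -> R),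
      [/\ forall n, bounded_integral X (Hn n) (Yn n),
          forall t w i, 0 <= t <= T ->
            Hn n t w ord0 i @[n --> \oo] --> H t w ord0 i &
          emery_dist (Yn n) Y @[n --> \oo] --> 0%E]].

Definition admissible_with_integral {d : nat} (X : R -> Omega -> 'rV[R]_d)
    (H : R -> Omega -> 'rV[R]_d) (Y : R -> Omega -> R) : Prop :=
  [/\ predictable H, stochastic_integral X H Y &
      exists c : R, forall t, 0 <= t <= T -> {ae P, forall w, - c <= Y t w}].

Definition terminal_gains {d : nat} (X : R -> Omega -> 'rV[R]_d) :
    set (Omega -> R) :=
  [set g | measurable_fun setT g /\
     exists H Y, admissible_with_integral X H Y /\ {ae P, forall w, g w = Y T w}].

Definition L1 (Q : probability Omega R) : set (Omega -> R) :=
  [set g | g \in Lfun Q 1].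

Definition M1 {d : nat} (X : R -> Omega -> 'rV[R]_d) :
    set (probability Omega R) :=
  [set Q : probability Omega R | [/\ Q `<< P, terminal_gains X `<=` L1 Q &
               forall g, terminal_gains X g -> ('E_Q[g] <= 0)%E]].

Definition equivalent_probabilities : set (probability Omega R) :=
  [set Q : probability Omega R | Q `<< P /\ P `<< Q].

Definition L1_nonneg (Q : probability Omega R) : set (Omega -> R) :=
  [set h | L1 Q h /\ {ae Q, forall w, 0 <= h w}].

Definition L1_closure (Q : probability Omega R) (A : set (Omega -> R)) :
    set (Omega -> R) :=
  [set h | L1 Q h /\ forall e : R, 0 < e ->
     exists2 a, A a & ('N[Q]_1[EFin \o (h \- a)%R] < e%:E)%E].

Definition gains_minus_L1_nonneg {d : nat} (X : R -> Omega -> 'rV[R]_d)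
    (Q : probability Omega R) : set (Omega -> R) :=
  [set g \- h | g in terminal_gains X & h in L1_nonneg Q].

(* The infimum of the empty set is +oo. *)
Definition f_id {d : nat} (X : R -> Omega -> 'rV[R]_d) (f : Omega -> R) :
    \bar R :=
  ereal_inf [set x%:E | x in [set x : R |
    (\bigcap_(Q in M1 X) L1_closure Q (gains_minus_L1_nonneg X Q))
      (fun w => f w - x)]].

End Filtration.

(* Main.v *)
Require Import Defs.
From HB Require Import structures.
From mathcomp Require Import all_boot all_order all_algebra.
From mathcomp Require Import all_classical all_reals all_analysis.
From mathcomp Require Import measurable_realfun.
From mathcomp Require Import ring lra.
Import Order.TTheory GRing.Theory Num.Theory.
Import numFieldNormedType.Exports.
Local Open Scope classical_set_scope.
Local Open Scope ring_scope.

Set Implicit Arguments.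
Unset Strict Implicit.
Unset Printing Implicit Defensive.

(** Write K for the terminal gains.  If f - x lies in the L1(Q)-closure of
    K - L1_+(Q), then integrating against Q in M1 gives E_Q[f] <= x, because
    E_Q is nonpositive on K and on - L1_+(Q); this is
    [superreplication_expectation] and yields the inequality >=.

    The inequality <= is a separation argument: if x bounds E_Q'[f] for all Q'
    in M1 but phi = f - x is outside the closure for some Q in M1, a further
    Q' << Q in M1 with E_Q'[phi] > 0 is produced, a contradiction.  Instead of
    the Hahn-Banach theorem and the duality of L1 and L^oo, the proof uses a
    projection in L2(Q), which is possible since elements of M1 need not have
    bounded densities.  Put s = (1 + |phi|)^(-1/2).  Then s phi is in L2(Q), and
      Z = { u in L2(Q) | u >= s (phi - g) a.e. for some g in K }
    is convex.  As u in L2(Q) implies u / s in L1(Q), with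
    |u / s|_1^2 <= |u|_2^2 E_Q[1 + |phi|], and as phi - u / s belongs to
    K - L1_+(Q) for u in Z, the distance of phi to K - L1_+(Q) bounds the norm
    away from 0 on Z.  The vector z of least norm in the closure of Z
    satisfies <z, u> >= c > 0 for all u in Z ([L2_convex_separation]).
    Since Z is stable under adding nonnegative functions and under subtracting
    s times truncated elements of K, z is nonnegative and s z is nonpositive on
    K; since s phi is in Z, s z is positive on phi
    ([exists_separating_density]).  Normalizing s z gives the density of Q'.

    This needs K to be a convex cone containing 0 ([terminal_gains_lin],
    [terminal_gains0]).  Linearity of the stochastic integral is proved along
    its construction: for simple integrands by concatenating partitions, for
    bounded ones by induction on the limits, and for general ones because
    Emery's distance satisfies a linear inequality ([emery_dist_lin]). *)

(** * Convex sets of square-integrable functions *)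

Lemma geometric_half_sum_le2 (R : realType) n :
  \sum_(0 <= k < n) ((2 : R) ^+ k)^-1 <= 2.
Proof.
suff -> : \sum_(0 <= k < n) ((2 : R) ^+ k)^-1 = 2 - 2 * (2 ^+ n)^-1.
  by rewrite gerBl mulr_ge0// invr_ge0 exprn_ge0.
elim: n => [|n IHn]; first by rewrite big_geq// expr0; lra.
rewrite big_nat_recr//= IHn exprS.
by field; rewrite expf_neq0.
Qed.

(** By 2 |x| <= 2^k x^2 + 2^-k the increments are absolutely summable. *)
Lemma cvgn_weighted_increments (R : realType) (u : nat -> R) (M : R) :
  (forall n, \sum_(0 <= k < n) 2 ^+ k * (u k.+1 - u k) ^+ 2 <= M) -> cvgn u.
Proof.
move=> uM.
have cd : cvgn (fun n => \sum_(0 <= k < n) `|u k.+1 - u k|).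
  apply: nondecreasing_is_cvgn.
    by apply/nondecreasing_seqP => n; rewrite big_nat_recr//= lerDl.
  exists ((M + 2) / 2) => _ [n _ <-].
  rewrite ler_pdivlMr//.
  apply: (@le_trans _ _ (\sum_(0 <= k < n)
      (2 ^+ k * (u k.+1 - u k) ^+ 2 + (2 ^+ k)^-1))).
    rewrite mulr_suml; apply: ler_sum => k _ /=.
    rewrite -(real_normK (num_real (u k.+1 - u k))).
    have p0 : 0 < (2 : R) ^+ k by rewrite exprn_gt0.
    set a := `|_|; set p := 2 ^+ k in p0 *.
    rewrite -subr_ge0.
    have -> : p * a ^+ 2 + p^-1 - a * 2 = p^-1 * (p * a - 1) ^+ 2.
      by field; rewrite gt_eqF.
    by rewrite mulr_ge0 ?invr_ge0 ?sqr_ge0// ltW.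
  by rewrite big_split/= lerD//; exact: geometric_half_sum_le2.
have cs : cvgn (series (telescope u)).
  apply: normed_cvg; rewrite /normed_series_of seriesEnat.
  exact: cd.
have -> : u = (fun n => series (telescope u) n + u 0).
  by rewrite telescopeK; apply/funext => n; rewrite subrK.
by apply: is_cvgD => //; exact: is_cvg_cst.
Qed.

Lemma le0_geometric_half (R : realType) (x C : R) :
  (forall n, x <= (2 ^+ n)^-1 * C) -> x <= 0.
Proof.
move=> xC; rewrite leNgt; apply/negP => x0.
have C0 : 0 < C by have := xC 0%N; rewrite expr0 invr1 mul1r; exact: lt_le_trans.
have := xC (Num.bound (C / x)); rewrite leNgt => /negP; apply.
rewrite mulrC ltr_pdivrMr ?exprn_gt0// -ltr_pdivrMl// mulrC.
apply: (lt_trans (archi_boundP _)); first by rewrite divr_ge0 ?ltW.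
by rewrite -natrX ltr_nat ltn_expl.
Qed.

Section square_integrable.
Context d {T : measurableType d} {R : realType} (mu : {measure set T -> \bar R}).
Implicit Types u v w : T -> R.

Lemma le_integrableR u v : measurable_fun setT u -> (forall x, `|u x| <= v x) ->
  mu.-integrable setT (EFin \o v) -> mu.-integrable setT (EFin \o u).
Proof.
move=> mu_ uv; apply: le_integrable => //; first exact/measurable_EFinP.
by move=> x _ /=; rewrite lee_fin (le_trans (uv x))// ler_norm.
Qed.

Definition L2 u :=
  measurable_fun setT u /\ mu.-integrable setT (EFin \o (fun x => u x ^+ 2)).

Definition inner u v : R := \int[mu]_x (u x * v x).

Lemma L2_integrableM u v : L2 u -> L2 v ->
  mu.-integrable setT (EFin \o (fun x => u x * v x)).
Proof.
move=> [mfu iu] [mfv iv].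
apply: (@le_integrableR _ (fun x => u x ^+ 2 + v x ^+ 2)).
- exact: measurable_funM.
- move=> x; rewrite normrM -(real_normK (num_real (u x))) -(real_normK (num_real (v x))).
  by nra.
- rewrite (_ : _ \o _ = (EFin \o (fun x => u x ^+ 2)) \+ (EFin \o (fun x => v x ^+ 2)))//.
  exact: integrableD.
Qed.

Lemma L2Z a u : L2 u -> L2 (fun x => a * u x).
Proof.
move=> [mfu iu]; split; first exact: measurable_funM.
have -> : EFin \o (fun x => (a * u x) ^+ 2) =
    (fun x => (a ^+ 2)%:E * (u x ^+ 2)%:E)%E.
  by apply/funext => x /=; rewrite exprMn EFinM.
exact: integrableZl.
Qed.

Lemma L2D u v : L2 u -> L2 v -> L2 (fun x => u x + v x).
Proof.
move=> Lu Lv; have [mfu iu] := Lu; have [mfv iv] := Lv.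
have mD : measurable_fun setT (fun x => u x + v x) by exact: measurable_funD.
split => //; apply: (@le_integrableR _ (fun x => (2 * u x) * u x + (2 * v x) * v x)).
- exact: measurable_funX.
- by move=> x; rewrite ger0_norm ?sqr_ge0//; have := sqr_ge0 (u x - v x); nra.
- rewrite (_ : _ \o _ = (EFin \o (fun x => (2 * u x) * u x)) \+
     (EFin \o (fun x => (2 * v x) * v x)))//.
  by apply: integrableD => //; apply: L2_integrableM => //; exact: L2Z.
Qed.

Lemma L2B u v : L2 u -> L2 v -> L2 (fun x => u x - v x).
Proof.
move=> Lu Lv; rewrite (_ : (fun _ => _) = (fun x => u x + -1 * v x)).
  by apply: L2D => //; exact: L2Z.
by apply/funext => x; rewrite mulN1r.
Qed.

Lemma innerC u v : inner u v = inner v u.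
Proof. by apply: eq_Rintegral => x _; rewrite mulrC. Qed.

Lemma innerDl u v w : L2 u -> L2 v -> L2 w ->
  inner (fun x => u x + v x) w = inner u w + inner v w.
Proof.
move=> Lu Lv Lw; rewrite /inner -RintegralD//; [|exact: L2_integrableM..].
by apply: eq_Rintegral => x _; rewrite mulrDl.
Qed.

Lemma innerZl a u w : L2 u -> L2 w -> inner (fun x => a * u x) w = a * inner u w.
Proof.
move=> Lu Lw; rewrite /inner -RintegralZl//; last exact: L2_integrableM.
by apply: eq_Rintegral => x _; rewrite mulrA.
Qed.

Lemma inner_comb a b u v : L2 u -> L2 v ->
  inner (fun x => a * u x + b * v x) (fun x => a * u x + b * v x) =
  a ^+ 2 * inner u u + 2 * (a * b) * inner u v + b ^+ 2 * inner v v.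
Proof.
move=> Lu Lv; have Lau := L2Z a Lu; have Lbv := L2Z b Lv.
rewrite innerDl//; last exact: L2D.
rewrite !innerZl//; [|exact: L2D..].
rewrite ![inner _ (fun x => _ + _)]innerC !innerDl// !innerZl// (innerC v u).
by ring.
Qed.

Lemma inner_sub u v : L2 u -> L2 v ->
  inner (fun x => u x - v x) (fun x => u x - v x) =
  inner u u - 2 * inner u v + inner v v.
Proof.
move=> Lu Lv; transitivity
    (inner (fun x => 1 * u x + (-1) * v x) (fun x => 1 * u x + (-1) * v x)).
  by congr inner; apply/funext => x; ring.
by rewrite inner_comb//; ring.
Qed.

Lemma inner_ge0 u : 0 <= inner u u.
Proof. by apply: Rintegral_ge0 => x _; rewrite -expr2 sqr_ge0. Qed.

(** Expands the square of l u - e v for e = 1 or -1.  With the weight l free,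
    this replaces the Cauchy-Schwarz inequality and spares its square roots. *)
Lemma inner_young l u v : 0 < l -> L2 u -> L2 v ->
  2 * `|inner u v| <= l * inner u u + l^-1 * inner v v.
Proof.
move=> l0 Lu Lv; have l0' : l != 0 by rewrite gt_eqF.
have h e : e ^+ 2 = 1 -> 2 * (e * inner u v) <= l * inner u u + l^-1 * inner v v.
  move=> e2; have := inner_ge0 (fun x => l * u x + (- e) * v x).
  rewrite inner_comb// sqrrN e2 => h.
  rewrite -subr_ge0 -(pmulr_lge0 _ l0); apply: le_trans h _.
  by rewrite le_eqVlt; apply/orP; left; apply/eqP; field.
have := h 1 (expr1n _ _); have := h (-1) (etrans (sqrrN 1) (expr1n _ _)).
rewrite mul1r mulN1r.
by case: (lerP 0 (inner u v)) => i0; [rewrite ger0_norm|rewrite ltr0_norm].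
Qed.

(** The Riesz-Fischer theorem for a sequence that converges geometrically.  The
    sum of the 2^n (z (n+1) - z n)^2 has a finite integral, so it is finite
    almost everywhere and z converges there; Fatou's lemma then transfers the
    bounds on z m - z k to the limit. *)
Lemma L2_limit (z : nat -> T -> R) : (forall n, L2 (z n)) ->
  (forall k m, (k <= m)%N ->
    inner (fun x => z m x - z k x) (fun x => z m x - z k x) <= (4 ^+ k)^-1) ->
  exists zoo, L2 zoo /\ forall k,
    inner (fun x => zoo x - z k x) (fun x => zoo x - z k x) <= (4 ^+ k)^-1.
Proof.
move=> Lz zC; have mz n : measurable_fun setT (z n) by have [] := Lz n.
have LB m k := L2B (Lz m) (Lz k).
(* The upper limit is measurable without any convergence. *)
pose zoo x := fine (limn_esup (fun n => (z n x)%:E)).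
have mzoo : measurable_fun setT zoo.
  apply: (@measurableT_comp _ _ _ _ _ _ fine) => //.
  by apply: measurable_fun_limn_esup => n; exact/measurable_EFinP.
pose h n x : \bar R := (2 ^+ n * (z n.+1 x - z n x) ^+ 2)%:E.
have h0 n x : (0 <= h n x)%E.
  by rewrite lee_fin mulr_ge0 ?sqr_ge0// exprn_ge0.
have mh n : measurable_fun setT (h n).
  by apply/measurable_EFinP; apply: measurable_funM => //; have [] := LB n.+1 n;
     move=> *; exact: measurable_funX.
have intZ m k : (k <= m)%N ->
    (\int[mu]_x ((z m x - z k x) ^+ 2)%:E <= ((4 ^+ k)^-1)%:E)%E.
  move=> km; have := zC k m km; rewrite -lee_fin; apply: le_trans.
  rewrite /inner /Rintegral fineK; last first.
    by apply: integrable_fin_num => //; exact: (L2_integrableM (LB m k) (LB m k)).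
  by rewrite le_eqVlt; apply/orP; left; apply/eqP; apply: eq_integral.
(* The n-th term integrates to at most 2^n 4^-n = 2 / 2^(n+1). *)
have inth : mu.-integrable setT (fun x => \sum_(n <oo) h n x)%E.
  apply/integrableP; split; first exact: ge0_emeasurable_sum.
  under eq_integral do rewrite gee0_abs ?nneseries_ge0//.
  rewrite integral_nneseries//.
  apply: (@le_lt_trans _ _ 2%:E); last exact: ltry.
  apply: le_trans (epsilon_trick0 xpredT (ler0n R 2)).
  apply: lee_nneseries => [n _ _|n _]; first exact: integral_ge0.
  rewrite /h; under eq_integral do rewrite EFinM.
  rewrite ge0_integralZl//; last 2 first.
  - by apply/measurable_EFinP; apply: measurable_funX; have [] := LB n.+1 n.
  - by move=> x _; rewrite lee_fin sqr_ge0.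
  apply: (le_trans (lee_wpmul2l _ (intZ n.+1 n (leqnSn n)))).
    by rewrite lee_fin exprn_ge0.
  rewrite -EFinM lee_fin natrX exprS.
  rewrite (_ : 4 = 2 * 2); last by ring.
  rewrite exprMn le_eqVlt; apply/orP; left; apply/eqP.
  by field; rewrite expf_neq0.
have zae : {ae mu, forall x, z ^~ x @ \oo --> zoo x}.
  apply: filterS (integrable_ae measurableT inth) => x /(_ I) hx.
  have /cvg_ex[l zl] : cvgn (z ^~ x).
    apply: (@cvgn_weighted_increments _ _ (fine (\sum_(n <oo) h n x))) => n.
    rewrite -lee_fin fineK// -sumEFin.
    exact: (@nneseries_lim_ge R (h ^~ x) xpredT 0 n (fun i _ _ => h0 i x)).
  suff -> : zoo x = l by [].
  by rewrite /zoo (@cvg_limn_einf_sup _ _ l%:E)//; apply: cvg_EFin => //; exact: nearW.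
have key k : (\int[mu]_x ((zoo x - z k x) ^+ 2)%:E <= ((4 ^+ k)^-1)%:E)%E.
  pose f m x := ((z m x - z k x) ^+ 2)%:E.
  have mf m : measurable_fun setT (f m).
    by apply/measurable_EFinP; apply: measurable_funX; have [] := LB m k.
  have f0 m x : (0 <= f m x)%E by rewrite lee_fin sqr_ge0.
  have -> : (\int[mu]_x ((zoo x - z k x) ^+ 2)%:E =
             \int[mu]_x (limn_einf (f ^~ x)))%E.
    apply: ae_eq_integral => //.
    - by apply/measurable_EFinP; apply: measurable_funX; exact: measurable_funB.
    - rewrite (_ : (fun _ => _) = (fun x => - limn_esup (-%E \o f ^~ x))%E).
        apply: measurableT_comp => //; apply: measurable_fun_limn_esup => m.
        exact: measurableT_comp.
      by apply/funext => x; rewrite limn_esupN oppeK.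
    - apply: filterS zae => x zx _.
      rewrite (@cvg_limn_einf_sup _ _ ((zoo x - z k x) ^+ 2)%:E)//.
      apply: cvg_EFin; first exact: nearW.
      apply: cvgM; apply: cvgB => //; exact: cvg_cst.
  apply: le_trans; first exact: fatou.
  rewrite limn_einf_lim; apply: lime_le; first exact: is_cvg_einfs.
  near=> n.
  apply: (@le_trans _ _ (\int[mu]_x f n x)%E).
    by apply: ereal_inf_lbound; exists n => //=.
  by apply: intZ; near: n; exists k.
have LBk k : L2 (fun x => zoo x - z k x).
  split; first exact: measurable_funB.
  apply/integrableP; split.
    by apply/measurable_EFinP; apply: measurable_funX; exact: measurable_funB.
  apply: le_lt_trans (ltry ((4 ^+ k)^-1)); apply: le_trans (key k).
  by under eq_integral do rewrite gee0_abs ?lee_fin ?sqr_ge0//.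
exists zoo; split.
  have := L2D (LBk 0%N) (Lz 0%N).
  by rewrite (_ : (fun _ => _) = zoo)//; apply/funext => x; rewrite subrK.
move=> k; rewrite -lee_fin /inner /Rintegral fineK; last first.
  by apply: integrable_fin_num => //; exact: (L2_integrableM (LBk k) (LBk k)).
by apply: le_trans (key k); rewrite le_eqVlt; apply/orP; left; apply/eqP; apply: eq_integral.
Unshelve. all: by end_near. Qed.

(** The vector z of least norm in the closure of Z is the limit of a minimizing
    sequence, which is Cauchy by the parallelogram identity.  Minimality along
    the segment from z to u gives <z, u> >= |z|^2 >= c.  As z may
    lie outside Z, the estimate is made on the n-th approximation, with step
    2^-n on the segment, and n tends to infinity. *)
Lemma L2_convex_separation (Z : set (T -> R)) (c : R) :
  Z !=set0 -> (forall u, Z u -> L2 u) ->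
  (forall t u v, 0 <= t <= 1 -> Z u -> Z v ->
     Z (fun x => (1 - t) * u x + t * v x)) ->
  (forall u, Z u -> c <= inner u u) ->
  exists z, L2 z /\ forall u, Z u -> c <= inner z u.
Proof.
move=> [u0 Zu0] ZL Zconv Zc.
pose N := [set inner u u | u in Z].
have infN : has_inf N.
  by split; [exists (inner u0 u0), u0|exists c => _ [u Zu <-]; exact: Zc].
pose delta := inf N.
have cdelta : c <= delta.
  by apply: lb_le_inf; [case: infN|move=> _ [u Zu <-]; exact: Zc].
have deltaP u : Z u -> delta <= inner u u.
  by move=> Zu; apply: inf_lbound; [case: infN|exists u].
have /choice[z zP] n : exists u, Z u /\ inner u u <= delta + (4 ^+ n)^-1 / 4.
  have e0 : 0 < (4 ^+ n)^-1 / 4 :> R by rewrite divr_gt0// invr_gt0 exprn_gt0.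
  have [_ [u Zu <-] /ltW ulE] := inf_adherent e0 infN.
  by exists u.
have Zz n : Z (z n) by case: (zP n).
have Lz n := ZL _ (Zz n).
have zC k m : (k <= m)%N ->
    inner (fun x => z m x - z k x) (fun x => z m x - z k x) <= (4 ^+ k)^-1.
  move=> km; rewrite inner_sub//.
  have half : 0 <= (1/2 : R) <= 1 by apply/andP; split; lra.
  have := deltaP _ (Zconv (1/2) _ _ half (Zz m) (Zz k)).
  rewrite inner_comb//; have [_ zm] := zP m; have [_ zk] := zP k.
  have : ((4 : R) ^+ m)^-1 <= (4 ^+ k)^-1.
    by rewrite lef_pV2 ?posrE ?exprn_gt0// ler_weXn2l// ler1n.
  by move: zm zk; rewrite (_ : 1 - 1 / 2 = 1 / 2 :> R); [nra|field].
have [zoo [Lzoo zooP]] := L2_limit Lz zC.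
exists zoo; split => // u Zu; apply: le_trans cdelta _.
rewrite -subr_le0.
apply: (@le0_geometric_half _ _ (delta + 2 * inner u u + 2 * `|inner zoo u| + 2)) => n.
have Lu := ZL _ Zu.
have [e eE] : exists e : R, (2 ^+ n)^-1 = e by eexists.
rewrite eE.
have e0 : 0 < e by rewrite -eE invr_gt0 exprn_gt0.
have e1 : e <= 1 by rewrite -eE invf_le1 ?exprn_gt0// exprn_ege1// ler1n.
have e2 : (4 ^+ n)^-1 = e ^+ 2.
  rewrite (_ : 4 = 2 ^+ 2 :> R); last by ring.
  by rewrite -eE exprVn -!exprM mulnC.
have e01 : 0 <= e <= 1 by rewrite ltW.
have := deltaP _ (Zconv _ _ _ e01 (Zz n) Zu).
rewrite inner_comb//; have [_] := zP n; rewrite e2 => zn.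
have := inner_young (l := e^-1) _ (L2B Lzoo (Lz n)) Lu.
rewrite invr_gt0 e0 invrK => /(_ isT).
have -> : inner (fun x => zoo x - z n x) u = inner zoo u - inner (z n) u.
  rewrite (_ : (fun _ => _) = (fun x => zoo x + (-1) * z n x)).
    by rewrite innerDl ?innerZl// ?mulN1r//; exact: L2Z.
  by apply/funext => x; rewrite mulN1r.
have : e^-1 * inner (fun x => zoo x - z n x) (fun x => zoo x - z n x) <= e.
  by rewrite mulrC ler_pdivrMr// -expr2 -e2; exact: zooP.
have := inner_ge0 u; have := inner_ge0 (z n).
have := ler_norm (- inner zoo u); rewrite normrN.
have := ler_norm (- (inner zoo u - inner (z n) u)); rewrite normrN.
have := normr_ge0 (inner zoo u).
set w := inner zoo u; set s := inner (z n) u; set b := inner u u; set a := inner (z n) (z n).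
set q := `|w|; set r := `|w - s|; set p := e^-1 * _.
move: zn; rewrite -/a => zn q0 rws qw a0 b0 pe young conv.
(* [r2] bounds the error of replacing z n by zoo; minimality, [conv], becomes a
   lower bound on s after division by e. *)
have r2 : 2 * r <= e * (1 + b) by lra.
have ews : s <= w + e * (1 + b) / 2 by lra.
have : e * (2 * (1 - e) * s) >= e * (2 * delta - e * (delta + 1/4 + b)).
  have : (1 - e) ^+ 2 * a <= (1 - e) ^+ 2 * (delta + e ^+ 2 / 4).
    by rewrite ler_wpM2l ?sqr_ge0.
  have : (1 - e) ^+ 2 * (e ^+ 2 / 4) <= e ^+ 2 / 4.
    have : 0 <= e * (2 - e) by rewrite mulr_ge0 ?(ltW e0)//; lra.
    by move=> h; rewrite ler_piMl//; [rewrite divr_ge0// sqr_ge0|lra].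
  by nra.
rewrite ler_pM2l// => h.
have : 2 * (1 - e) * s <= 2 * (1 - e) * (w + e * (1 + b) / 2).
  by rewrite ler_wpM2l//; lra.
have : e * (- w) <= e * q by rewrite ler_wpM2l// ltW.
have : 0 <= e * (e * (1 + b)).
  by rewrite !mulr_ge0// ?ltW//; lra.
have : 0 <= e * delta.
  rewrite mulr_ge0 ?(ltW e0)//.
  by apply: lb_le_inf; [case: infN|move=> _ [v _ <-]; exact: inner_ge0].
have : 0 <= e * q by rewrite mulr_ge0 ?(ltW e0).
have : 0 <= e * b by rewrite mulr_ge0 ?(ltW e0).
by lra.
Qed.

End square_integrable.

(** * Probabilities given by a density *)

Section density.
Context d {T : measurableType d} {R : realType} (Q : probability T R).
Variables (rho : T -> R).
Hypotheses (mrho : measurable_fun setT rho) (rho0 : forall x, 0 <= rho x)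
  (rho1 : (\int[Q]_x (rho x)%:E = 1)%E).

(** The hypotheses on rho are arguments, so that the instance of probability
    below can be inferred from the term alone. *)
Definition density_prob of measurable_fun setT rho & (forall x, 0 <= rho x) &
  (\int[Q]_x (rho x)%:E = 1)%E := fun A : set T => (\int[Q]_(x in A) (rho x)%:E)%E.

Local Notation Q' := (density_prob mrho rho0 rho1).

Let density0 : Q' set0 = 0%E.
Proof. exact: integral_set0. Qed.

Let density_ge0 A : (0 <= Q' A)%E.
Proof. by apply: integral_ge0 => x _; rewrite lee_fin. Qed.

Let density_sigma_additive : semi_sigma_additive Q'.
Proof.
apply: semi_sigma_additive_nng_induced; first exact/measurable_EFinP.
by move=> x; rewrite lee_fin.
Qed.

HB.instance Definition _ := isMeasure.Build _ _ _
  Q' density0 density_ge0 density_sigma_additive.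

Let density_setT : Q' [set: T] = 1%E.
Proof. exact: rho1. Qed.

HB.instance Definition _ :=
  @Measure_isProbability.Build _ _ R Q' density_setT.

Let density_dominates : Q' `<< Q.
Proof.
apply/null_content_dominatesP => A mA QA0; apply: null_set_integral => //.
exact/measurable_funTS/measurable_EFinP.
Qed.

Let density_RN : ae_eq Q setT (Radon_Nikodym_SigmaFinite.f Q' Q) (EFin \o rho).
Proof.
apply: integral_ae_eq => //.
- exact: Radon_Nikodym_SigmaFinite.f_integrable.
- exact/measurable_EFinP.
- by move=> A _ mA; rewrite -Radon_Nikodym_SigmaFinite.f_integral.
Qed.

(** rho is almost everywhere the Radon-Nikodym derivative of the measure that
    it defines, so the change of variables formula for that derivative
    applies. *)
Lemma exists_density : exists Q1 : probability T R, Q1 `<< Q /\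
  forall g : T -> R, measurable_fun setT g ->
    Q.-integrable setT (EFin \o (fun x => g x * rho x)) ->
    Q1.-integrable setT (EFin \o g) /\
    (\int[Q1]_x (g x)%:E = \int[Q]_x (g x * rho x)%:E)%E.
Proof.
exists Q'; split => // g mg ig.
have mf : measurable_fun setT (Radon_Nikodym_SigmaFinite.f Q' Q).
  exact: measurable_int (Radon_Nikodym_SigmaFinite.f_integrable density_dominates).
have mG : measurable_fun setT (EFin \o g) by exact/measurable_EFinP.
have mgr := measurable_int _ ig.
have i' : Q'.-integrable setT (EFin \o g).
  apply/integrableP; split => //.
  rewrite -(Radon_Nikodym_SigmaFinite.change_of_variables density_dominates)//; last first.
    exact: measurableT_comp.
  case/integrableP : ig => _; apply: le_lt_trans.
  rewrite le_eqVlt; apply/orP; left; apply/eqP.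
  apply: ae_eq_integral => //.
  - by apply: emeasurable_funM => //; exact: measurableT_comp.
  - exact: measurableT_comp.
  - apply: filterS density_RN => x /(_ I) -> _ /=.
    by rewrite normrM (ger0_norm (rho0 x)).
split=> //.
rewrite -(Radon_Nikodym_change_of_variables density_dominates)//.
apply: ae_eq_integral => //.
  exact: emeasurable_funM.
apply: filterS2 (ae_eq_Radon_Nikodym_SigmaFinite density_dominates measurableT)
  density_RN => x /(_ I) + /(_ I) + _.
by move=> <- -> /=.
Qed.

End density.

(** * Separating an integrable function from a cone *)

Lemma ae_eq_integrable d (T : measurableType d) (R : realType)
    (mu : {measure set T -> \bar R}) (u v : T -> R) :
  measurable_fun setT v -> {ae mu, forall x, u x = v x} ->
  mu.-integrable setT (EFin \o u) -> mu.-integrable setT (EFin \o v) /\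
  (\int[mu]_x (v x)%:E = \int[mu]_x (u x)%:E)%E.
Proof.
move=> mv uv iu; have mu' := measurable_int _ iu.
have mv' : measurable_fun setT (EFin \o v) by exact/measurable_EFinP.
split; last by apply: ae_eq_integral => //; apply: filterS uv => x -> _.
apply/integrableP; split => //; case/integrableP : iu => _; apply: le_lt_trans.
rewrite le_eqVlt; apply/orP; left; apply/eqP.
apply: ae_eq_integral => //; [exact: measurableT_comp..|].
by apply: filterS uv => x /= -> _.
Qed.

(** With b = 1 + |phi|, multiplication by s takes phi and all bounded functions
    into L2, and division by s (that is, multiplication by r) takes L2 into
    L1. *)
Lemma exists_sqrt_weight d (T : measurableType d) (R : realType) (b : T -> R) :
  measurable_fun setT b -> (forall x, 1 <= b x) ->
  exists r s : T -> R, [/\ measurable_fun setT r, measurable_fun setT s,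
    forall x, r x ^+ 2 = b x, forall x, s x * r x = 1 & forall x, 0 < s x <= 1].
Proof.
move=> mb b1; have b0 x : 0 < b x by exact: lt_le_trans (b1 x).
exists (fun x => b x `^ 2^-1), (fun x => b x `^ (- 2^-1)).
have r1 x : 1 <= b x `^ 2^-1.
  have := @ge0_ler_powR R 2^-1 _ 1 (b x).
  by rewrite powR1 => -> //; rewrite nnegrE ?ler01// ltW.
have r0 x : 0 < b x `^ 2^-1 by exact: lt_le_trans (r1 x).
split.
- by apply: (@measurableT_comp _ _ _ _ _ _ (fun y : R => y `^ 2^-1)).
- by apply: (@measurableT_comp _ _ _ _ _ _ (fun y : R => y `^ (- 2^-1))).
- by move=> x; rewrite powR12_sqrt ?ltW// sqr_sqrtr// ltW.
- by move=> x; rewrite powRN mulVf// gt_eqF.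
- by move=> x; rewrite powRN invr_gt0 r0 invf_le1 ?r0 ?r1.
Qed.

Lemma affine_bound_slope_ge0 (R : realType) (c a b : R) :
  (forall t, 0 < t -> c <= a + t * b) -> 0 <= b.
Proof.
move=> h; rewrite leNgt; apply/negP => b0.
have t0 : 0 < (`|a - c| + 1) / - b by rewrite divr_gt0 ?oppr_gt0// ltr_wpDl.
have := h _ t0.
rewrite [X in a + X](_ : _ = - (`|a - c| + 1)); last by field; rewrite lt_eqF.
by have := ler_norm (a - c); lra.
Qed.

Section separating_density.
Context d {T : measurableType d} {R : realType} (Q : probability T R).
Variables (K : set (T -> R)) (phi : T -> R).
Hypotheses (K0 : K (fun=> 0))
  (KD : forall g h, K g -> K h -> K (fun x => g x + h x))
  (KZ : forall a g, 0 < a -> K g -> K (fun x => a * g x))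
  (K_L1 : K `<=` L1 Q)
  (K_lb : forall g, K g -> exists c : R, {ae Q, forall x, - c <= g x})
  (phi_L1 : L1 Q phi)
  (phi_far : ~ L1_closure Q [set g \- h | g in K & h in L1_nonneg Q] phi).

Let L1_int g : L1 Q g <-> Q.-integrable setT (EFin \o g).
Proof. exact: Lfun1_integrable. Qed.

Let L1_meas g : L1 Q g -> measurable_fun setT g.
Proof. by move=> /L1_int/measurable_int/measurable_EFinP. Qed.

Let mphi : measurable_fun setT phi. Proof. exact: L1_meas. Qed.

Let L2_bounded (u : T -> R) (B : R) : measurable_fun setT u ->
  (forall x, `|u x| <= B) -> L2 Q u.
Proof.
move=> mu_ uB; split => //; apply: (@le_integrableR _ _ _ _ _ (cst (B ^+ 2))).
- exact: measurable_funX.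
- move=> x; rewrite normrX /=; have := uB x; have := normr_ge0 (u x).
  by move=> ? ?; rewrite lerXn2r// nnegrE (le_trans _ (uB x)).
- exact: finite_measure_integrable_cst.
Qed.

(** For y above phi - g, phi - y = g - (g - phi + y) is in K - L1_+(Q), so that
    the L1-norm of y is the distance of phi to a point of this set. *)
Let far : exists2 e : R, 0 < e & forall g (y : T -> R), K g ->
  measurable_fun setT y -> Q.-integrable setT (EFin \o y) ->
  {ae Q, forall x, phi x - g x <= y x} -> e <= \int[Q]_x `|y x|.
Proof.
apply: contrapT => nofar; apply: phi_far; split => // e e0.
apply: contrapT => noa; apply: nofar; exists e => // g y Kg my iy gy.
rewrite leNgt; apply/negP => ye; apply: noa.
have ig : Q.-integrable setT (EFin \o g) by exact/L1_int/K_L1.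
have iphi : Q.-integrable setT (EFin \o phi) by exact/L1_int.
exists (g \- (fun x => g x - phi x + y x)).
  exists g => //; exists (fun x => g x - phi x + y x) => //; split.
    apply/L1_int; rewrite (_ : _ \o _ =
      ((EFin \o g) \- (EFin \o phi)) \+ (EFin \o y))%E//.
    by apply: integrableD => //; exact: integrableB.
  by apply: filterS gy => x; lra.
rewrite Lnorm1.
rewrite (_ : (fun x => _) = (fun x => `|y x|%:E)); last first.
  by apply/funext => x /=; congr (`| _ |%:E); ring.
rewrite -[ltLHS]fineK ?lte_fin//.
by apply: integrable_fin_num => //; exact: (integrable_norm iy).
Qed.

Let KZ0 a g : 0 <= a -> K g -> K (fun x => a * g x).
Proof.
rewrite le_eqVlt => /predU1P[<- _|]; last exact: KZ.
by rewrite (_ : (fun=> _) = (fun=> 0))//; apply/funext => x; rewrite mul0r.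
Qed.

(** The function z that separates the set Z below from 0 in L2(Q) yields the
    density: s z, up to normalization and modification on a null set.  The
    factor s lets L2(Q) do the work although phi and the elements of K are only
    integrable. *)
Lemma exists_separating_density : exists rho : T -> R,
  [/\ measurable_fun setT rho, (forall x, 0 <= rho x),
      (\int[Q]_x (rho x)%:E = 1)%E,
      (forall g, K g -> Q.-integrable setT (EFin \o (fun x => g x * rho x)) /\
        (\int[Q]_x (g x * rho x)%:E <= 0)%E) &
      Q.-integrable setT (EFin \o (fun x => phi x * rho x)) /\
      (0 < \int[Q]_x (phi x * rho x)%:E)%E].
Proof.
have [e e0 farP] := far.
have iphi : Q.-integrable setT (EFin \o phi) by exact/L1_int.
have [r [s [mr ms r2 sr s01]]] := @exists_sqrt_weight _ _ _ (fun x => 1 + `|phi x|)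
   (measurable_funD (measurable_cst _) (measurableT_comp (@normr_measurable _ _) mphi))
   (fun x => ler_wpDr (normr_ge0 _) (lexx 1)).
have s0 x : 0 < s x by case/andP : (s01 x).
have s1 x : s x <= 1 by case/andP : (s01 x).
have Lr : L2 Q r.
  split => //; rewrite (_ : _ \o _ = (EFin \o cst 1) \+ (EFin \o (fun x => `|phi x|))); last first.
    by apply/funext => x /=; rewrite r2.
  apply: integrableD => //; first exact: finite_measure_integrable_cst.
  exact: integrable_norm.
have Ls : L2 Q s.
  by apply: (L2_bounded ms (B := 1)) => x; rewrite gtr0_norm.
have Lbs (u : T -> R) (B : R) : measurable_fun setT u -> (forall x, `|u x| <= B) ->
    L2 Q (fun x => u x * s x).
  move=> mu_ uB; apply: (@L2_bounded _ B); first exact: measurable_funM.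
  move=> x; rewrite normrM (gtr0_norm (s0 x)).
  by apply: le_trans (uB x); rewrite ler_piMr.
have Lphis : L2 Q (fun x => phi x * s x).
  split; first exact: measurable_funM.
  apply: (@le_integrableR _ _ _ _ _ (fun x => `|phi x|)).
  - by apply: measurable_funX; exact: measurable_funM.
  - move=> x; rewrite ger0_norm ?sqr_ge0// exprMn -(real_normK (num_real (phi x))).
    rewrite expr2 -mulrA ler_piMr//.
    have : s x ^+ 2 * r x ^+ 2 = 1 by rewrite -exprMn sr expr1n.
    rewrite r2; have := normr_ge0 (phi x); have := sqr_ge0 (s x); nra.
  - exact: integrable_norm.
pose Z := [set u | L2 Q u /\
  exists2 g, K g & {ae Q, forall x, (phi x - g x) * s x <= u x}].
have Zphi : Z (fun x => phi x * s x).
  by split => //; exists (fun=> 0) => //; apply: aeW => x; rewrite subr0.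
pose M := inner Q r r.
have M0 : 0 < M.
  apply: lt_le_trans ltr01 _.
  have -> : 1 = \int[Q]_x (cst 1 x) :> R.
    rewrite Rintegral_cst// mul1r; apply: (congr1 fine (esym _ : 1%E = _)).
    exact: probability_setT.
  apply: le_Rintegral => //; first exact: finite_measure_integrable_cst.
    exact: L2_integrableM.
  by move=> x _; rewrite -expr2 r2 lerDl.
(* Young's inequality with weight M / e turns the L1-bound e into an L2-bound. *)
have Zc u : Z u -> e ^+ 2 / M <= inner Q u u.
  move=> [Lu [g Kg gu]]; have [mu_ _] := Lu.
  have : e <= inner Q (fun x => `|u x|) r.
    have iur := L2_integrableM Lu Lr.
    have -> : inner Q (fun x => `|u x|) r = \int[Q]_x `|u x * r x|.
      apply: eq_Rintegral => x _; rewrite normrM; congr (_ * _).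
      by rewrite ger0_norm// ltW// -(pmulr_rgt0 _ (s0 x)) sr.
    apply: (farP g) => //; first exact: measurable_funM.
    apply: filterS gu => x; rewrite -(ler_pM2r (_ : 0 < r x)).
      by rewrite -mulrA sr mulr1.
    by rewrite -(pmulr_rgt0 _ (s0 x)) sr.
  have Lau : L2 Q (fun x => `|u x|).
    split; first exact: measurableT_comp.
    by under [X in EFin \o X]eq_fun do rewrite real_normK ?num_real//; case: Lu.
  have := @inner_young _ _ _ Q (M / e) _ _ (divr_gt0 M0 e0) Lau Lr.
  rewrite -/M (_ : inner Q (fun x => `|u x|) (fun x => `|u x|) = inner Q u u); last first.
    by apply: eq_Rintegral => x _; rewrite -!expr2 real_normK// num_real.
  rewrite invf_div divfK ?gt_eqF// => young ure.
  have := ler_norm (inner Q (fun x => `|u x|) r) => ure'.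
  have : e <= M / e * inner Q u u by lra.
  rewrite ler_pdivrMr// mulrAC ler_pdivlMr// -expr2.
  by rewrite [leRHS]mulrC.
have [z [Lz zP]] : exists z, L2 Q z /\ forall u, Z u -> e ^+ 2 / M <= inner Q z u.
  apply: L2_convex_separation Zc; first by eexists; exact: Zphi.
    by move=> u [].
  move=> t u v t01 [Lu [g Kg gu]] [Lv [h Kh hv]]; split.
    by apply: L2D; exact: L2Z.
  exists (fun x => (1 - t) * g x + t * h x).
    by apply: KD; apply: KZ0 => //; case/andP: t01 => *; rewrite ?subr_ge0.
  case/andP: t01 => t0 t1; have t1' : 0 <= 1 - t by rewrite subr_ge0.
  apply: filterS2 gu hv => x gux hvx.
  rewrite (_ : _ * s x = (1 - t) * ((phi x - g x) * s x) + t * ((phi x - h x) * s x)).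
    by rewrite lerD// ler_wpM2l.
  by ring.
(* Z is stable under adding t u for all t > 0. *)
have dual u g : L2 Q u -> K g -> {ae Q, forall x, - u x <= g x * s x} ->
    0 <= inner Q z u.
  move=> Lu Kg gu; apply: (@affine_bound_slope_ge0 _ (e ^+ 2 / M)
    (inner Q z (fun x => phi x * s x))) => t t0.
  rewrite ![inner Q z _]innerC -innerZl// -innerDl//; last exact: L2Z.
  rewrite innerC; apply: zP; split; first by apply: L2D => //; exact: L2Z.
  exists (fun x => t * g x); first exact: KZ.
  apply: filterS gu => x gux.
  have : t * - u x <= t * (g x * s x) by rewrite ler_wpM2l// ltW.
  by rewrite mulrBl mulrA mulrN; lra.
(* z is nonnegative: its negative part zm is a direction of Z. *)
pose zm x := Num.max (- z x) 0.
have zm_ge0 x : 0 <= zm x by rewrite /zm le_max lexx orbT.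
have [mz iz] := Lz.
have Lzm : L2 Q zm.
  have mzm : measurable_fun setT zm.
    by apply: measurable_maxr => //; exact: measurableT_comp.
  split => //; apply: (@le_integrableR _ _ _ _ _ (fun x => z x ^+ 2)) => //.
  - exact: measurable_funX.
  - move=> x; rewrite ger0_norm ?sqr_ge0// /zm maxEle.
    by case: ifPn => _; rewrite ?sqrrN// expr0n sqr_ge0.
have zm0 : inner Q zm zm = 0.
  apply/eqP; rewrite eq_le inner_ge0 andbT.
  have : 0 <= inner Q z zm.
    by apply: (dual _ (fun=> 0)) => //; apply: aeW => x; rewrite mul0r oppr_le0.
  rewrite (_ : inner Q z zm = - inner Q zm zm) ?oppr_ge0//.
  rewrite -mulN1r -innerZl//; apply: eq_Rintegral => x _.
  rewrite /zm maxEle; case: ifPn => _; ring.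
have zm_orth v : L2 Q v -> inner Q zm v = 0.
  move=> Lv; apply/eqP; rewrite -normr_le0 -(pmulr_rle0 _ (ltr0n R 2)).
  apply: (@le0_geometric_half _ _ (inner Q v v)) => n.
  have := @inner_young _ _ _ Q (2 ^+ n) _ _ _ Lzm Lv.
  by rewrite zm0 mulr0 add0r; apply; rewrite exprn_gt0.
pose zp x := z x + zm x.
have zp_ge0 x : 0 <= zp x by rewrite /zp /zm maxEle; case: ifPn => ?; lra.
have Lzp : L2 Q zp by exact: L2D.
have zpE v : L2 Q v -> inner Q zp v = inner Q z v.
  by move=> Lv; rewrite innerDl// zm_orth// addr0.
pose rho x := zp x * s x.
have rho_ge0 x : 0 <= rho x by rewrite mulr_ge0// ltW.
have irho : Q.-integrable setT (EFin \o rho) by exact: L2_integrableM.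
have mrho : measurable_fun setT rho by apply/measurable_EFinP/(measurable_int _ irho).
have iphirho : Q.-integrable setT (EFin \o (fun x => phi x * rho x)).
  have := L2_integrableM Lzp Lphis.
  by congr (_.-integrable _ _); apply/funext => x /=; rewrite /rho; congr EFin; ring.
have phirho : 0 < \int[Q]_x (phi x * rho x).
  apply: (@lt_le_trans _ _ (e ^+ 2 / M)); first by rewrite divr_gt0 ?exprn_gt0.
  apply: (le_trans (zP _ Zphi)); rewrite -zpE//.
  by rewrite le_eqVlt; apply/orP; left; apply/eqP; apply: eq_Rintegral => x _; rewrite /rho; ring.
pose m := \int[Q]_x rho x.
have intrho : (\int[Q]_x (rho x)%:E)%E = m%:E by rewrite fineK//; exact: integrable_fin_num.
have m0 : 0 < m.
  rewrite lt_def Rintegral_ge0// andbT; apply/eqP => m0.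
  have : ae_eq Q setT (EFin \o rho) (cst 0%E).
    apply/ae_eq_integral_abs => //; first exact/measurable_EFinP.
    by under eq_integral do rewrite /= ger0_norm//; rewrite intrho m0.
  move=> rho_ae0; move: phirho; rewrite /Rintegral (ae_eq_integral (cst 0%E))//.
  - by rewrite integral0 ltxx.
  - exact: measurable_int iphirho.
  - by apply: filterS rho_ae0 => x /(_ I) /= [->] _; rewrite mulr0.
have Krho g : K g -> Q.-integrable setT (EFin \o (fun x => g x * rho x)) /\
    (\int[Q]_x (g x * rho x)%:E <= 0)%E.
  move=> Kg; have [c0 gc0] := K_lb Kg; have mg := L1_meas (K_L1 Kg).
  (* k is g with the lower bound made to hold everywhere; its truncations kn
     are bounded, hence admitted by [dual], and Fatou's lemma removes them. *)
  pose c := `|c0|; pose k x := Num.max (- c) (g x).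
  have c_ge0 : 0 <= c by exact: normr_ge0.
  have mk : measurable_fun setT k by exact: measurable_maxr.
  have ck x : - c <= k x by rewrite le_max lexx.
  have kc x : 0 <= k x + c by rewrite -lerBlDr sub0r.
  have kg : {ae Q, forall x, k x = g x}.
    apply: filterS gc0 => x gx; apply/max_r; apply: le_trans gx.
    by rewrite lerN2 ler_norm.
  pose kn n x := Num.min (k x) n%:R.
  have mkn n : measurable_fun setT (kn n) by exact: measurable_minr.
  have knc n x : - c <= kn n x.
    by rewrite le_min ck/=; apply: (@le_trans _ _ 0); rewrite ?oppr_le0.
  have Lkn n : L2 Q (fun x => kn n x * s x).
    apply: (Lbs _ (Num.max c n%:R)) => // x.
    rewrite ler_norml; apply/andP; split.
      by apply: le_trans (knc n x); rewrite lerN2 le_max lexx.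
    by rewrite /kn ge_min !le_max lexx !orbT.
  have knrho n : \int[Q]_x (kn n x * rho x) <= 0.
    rewrite (_ : Rintegral _ _ _ = - inner Q z (fun x => - 1 * (kn n x * s x))).
      rewrite oppr_le0; apply: (dual _ g) => //; first exact: L2Z.
      apply: filterS kg => x kgx; rewrite mulN1r opprK.
      apply: ler_wpM2r; first exact: ltW.
      by rewrite /kn kgx ge_min lexx.
    rewrite innerC innerZl// mulN1r opprK innerC -zpE//.
    by apply: eq_Rintegral => x _; rewrite /rho; ring.
  have iknrho n : Q.-integrable setT (EFin \o (fun x => kn n x * rho x)).
    have := L2_integrableM Lzp (Lkn n).
    congr (_.-integrable _ _); apply/funext => x /=; rewrite /rho; congr EFin; ring.
  have icrho : Q.-integrable setT (EFin \o (fun x => c * rho x)).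
    by rewrite (_ : _ \o _ = (fun x => c%:E * (rho x)%:E)%E)//; exact: integrableZl.
  have icr : (\int[Q]_x (c * rho x)%:E = (c * m)%:E)%E.
    by under eq_integral do rewrite EFinM; rewrite integralZl// intrho.
  have knc_le n : (\int[Q]_x ((kn n x + c) * rho x)%:E <= (c * m)%:E)%E.
    under eq_integral do rewrite mulrDl EFinD.
    rewrite integralD_EFin//= icr -leeBrDr// subee//.
    rewrite -[leLHS]fineK; first by rewrite lee_fin; exact: knrho.
    exact: (integrable_fin_num measurableT (iknrho n)).
  have kc_le : (\int[Q]_x ((k x + c) * rho x)%:E <= (c * m)%:E)%E.
    pose F n x := ((kn n x + c) * rho x)%:E.
    have mF n : measurable_fun setT (F n).
      by apply/measurable_EFinP; apply: measurable_funM => //; exact: measurable_funD.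
    have F0 n x : (0 <= F n x)%E.
      by rewrite lee_fin mulr_ge0// -lerBlDr sub0r.
    rewrite (_ : (\int[Q]_x _ = \int[Q]_x limn_einf (F ^~ x))%E); last first.
      apply: eq_integral => x _; rewrite (@cvg_limn_einf_sup _ _ ((k x + c) * rho x)%:E)//.
      apply: cvg_near_cst; near=> n; congr ((_ + _) * _)%:E.
      apply/min_l; near: n; exact: nbhs_infty_ger.
    apply: le_trans; first exact: fatou.
    rewrite limn_einf_lim; apply: lime_le; first exact: is_cvg_einfs.
    apply: nearW => n; apply: le_trans (knc_le n).
    by apply: ereal_inf_lbound; exists n => /=.
  have mkr : measurable_fun setT (fun x => k x * rho x) by exact: measurable_funM.
  have ikc : Q.-integrable setT (EFin \o (fun x => (k x + c) * rho x)).
    apply/integrableP; split.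
      by apply/measurable_EFinP; apply: measurable_funM => //; exact: measurable_funD.
    apply: le_lt_trans (ltry (c * m)); apply: le_trans kc_le.
    rewrite le_eqVlt; apply/orP; left; apply/eqP; apply: eq_integral => x _ /=.
    by rewrite ger0_norm// mulr_ge0.
  have kE : (fun x => k x * rho x) = (fun x => (k x + c) * rho x - c * rho x).
    by apply/funext => x; ring.
  have ik : Q.-integrable setT (EFin \o (fun x => k x * rho x)).
    by rewrite kE; exact: (integrableB _ ikc icrho).
  have k_le0 : (\int[Q]_x (k x * rho x)%:E <= 0)%E.
    rewrite (_ : (\int[Q]_x _ = \int[Q]_x ((k x + c) * rho x - c * rho x)%:E)%E).
      by rewrite integralB_EFin//= icr leeBlDr// add0e.
    by apply: eq_integral => x _; congr EFin; ring.
  have kgr : {ae Q, forall x, k x * rho x = g x * rho x}.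
    by apply: filterS kg => x ->.
  have [//|ig Eg] := ae_eq_integrable _ kgr ik; first exact: measurable_funM.
  by rewrite Eg.
exists (fun x => m^-1 * rho x); split.
- exact: measurable_funM.
- by move=> x; rewrite mulr_ge0// invr_ge0 ltW.
- under eq_integral do rewrite EFinM.
  by rewrite integralZl// intrho -EFinM mulVf// gt_eqF.
- move=> g Kg; have [ig g0] := Krho g Kg.
  rewrite (_ : (fun x => g x * _) = (fun x => m^-1 * (g x * rho x))); last first.
    by apply/funext => x; ring.
  split.
    rewrite (_ : _ \o _ = (fun x => (m^-1)%:E * (g x * rho x)%:E)%E)//.
    exact: integrableZl.
  under eq_integral do rewrite mulrCA EFinM.
  by rewrite integralZl// mule_ge0_le0// lee_fin invr_ge0 ltW.
- rewrite (_ : (fun x => phi x * _) = (fun x => m^-1 * (phi x * rho x))); last first.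
    by apply/funext => x; ring.
  split.
    rewrite (_ : _ \o _ = (fun x => (m^-1)%:E * (phi x * rho x)%:E)%E)//.
    exact: integrableZl.
  under eq_integral do rewrite mulrCA EFinM.
  rewrite integralZl//; apply: mule_gt0; first by rewrite lte_fin invr_gt0.
  by rewrite -[ltRHS]fineK ?lte_fin//; exact: integrable_fin_num.
Unshelve. all: by end_near. Qed.
End separating_density.

(** * The cone of terminal gains *)

Section stochastic_cone.
Context {R : realType} {disp : measure_display} {Omega : measurableType disp}.
Variables (P : probability Omega R) (T : R) (F : R -> set (set Omega)).
Hypotheses (T_gt0 : 0 < T) (F_usual : usual_filtration P T F).

Lemma filtration_mono s t : 0 <= s -> s <= t -> t <= T -> F s `<=` F t.
Proof. by case: F_usual => _ + _ _; apply. Qed.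

Lemma measurable_wrtS (G1 G2 : set (set Omega)) (g : Omega -> R) :
  G1 `<=` G2 -> measurable_wrt G1 g -> measurable_wrt G2 g.
Proof. by move=> G12 mg _ B mB; apply: (sub_sigma_algebra2 G12); exact: mg. Qed.

Lemma measurable_wrt_measurable t (g : Omega -> R) : 0 <= t <= T ->
  measurable_wrt (F t) g -> measurable_fun setT g.
Proof.
move=> tT mg _ B mB; have [Fsub _ _ _] := F_usual.
have [sF Fm] := Fsub t tT.
apply: (@smallest_sub _ (sigma_algebra setT) (F t) measurable); last 2 first.
- exact: Fm.
- exact: mg.
- exact: sigma_algebra_measurable.
Qed.

Lemma adapted_measurable Y t : adapted T F Y -> 0 <= t <= T ->
  measurable_fun setT (Y t).
Proof. by move=> aY tT; apply: (measurable_wrt_measurable tT); exact: aY. Qed.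

Lemma adaptedD Y Z : adapted T F Y -> adapted T F Z ->
  adapted T F (fun t w => Y t w + Z t w).
Proof. by move=> aY aZ t tT; apply: measurable_funD; [exact: aY|exact: aZ]. Qed.

Lemma adaptedZ a Y : adapted T F Y -> adapted T F (fun t w => a * Y t w).
Proof. by move=> aY t tT; apply: measurable_funM => //; exact: aY. Qed.

Lemma adapted_sum n (Y : 'I_n -> R -> Omega -> R) :
  (forall i, adapted T F (Y i)) -> adapted T F (fun t w => \sum_i Y i t w).
Proof. by move=> aY t tT; apply: measurable_sum => i; exact: aY. Qed.

Lemma cadlagD (Y Z : R -> Omega -> R) : cadlag T Y -> cadlag T Z ->
  cadlag T (fun t w => Y t w + Z t w).
Proof.
move=> cY cZ w; have [Yr Yl] := cY w; have [Zr Zl] := cZ w.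
split=> t tT; first by apply: cvgD; [exact: Yr|exact: Zr].
by apply: is_cvgD; [exact: Yl|exact: Zl].
Qed.

Lemma cadlagZ (g : Omega -> R) (Y : R -> Omega -> R) : cadlag T Y ->
  cadlag T (fun t w => g w * Y t w).
Proof.
move=> cY w; have [Yr Yl] := cY w; split=> t tT.
  by apply: cvgM; [exact: cvg_cst|exact: Yr].
by apply: is_cvgM; [exact: is_cvg_cst|exact: Yl].
Qed.

Lemma cadlag_cst0 : cadlag T (fun (_ : R) (_ : Omega) => 0 : R).
Proof. by move=> w; split => t _; [exact: cvg_cst|exact: is_cvg_cst]. Qed.

Lemma cadlag_sum n (Y : 'I_n -> R -> Omega -> R) :
  (forall i, cadlag T (Y i)) -> cadlag T (fun t w => \sum_i Y i t w).
Proof.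
elim: n Y => [|n IHn] Y cY.
  rewrite (_ : (fun _ _ => _) = (fun _ _ => 0)); first exact: cadlag_cst0.
  by apply/funext => t; apply/funext => w; rewrite big_ord0.
rewrite (_ : (fun _ _ => _) =
    (fun t w => \sum_(i < n) Y (widen_ord (leqnSn n) i) t w + Y ord_max t w)).
  by apply: cadlagD => //; exact: IHn.
by apply/funext => t; apply/funext => w; rewrite big_ord_recr.
Qed.

Lemma cadlag_stopped (Y : R -> Omega -> R) r : cadlag T Y ->
  cadlag T (fun t => Y (Num.min r t)).
Proof.
move=> cY w; have [Yr Yl] := cY w; split=> t /andP[t0 tT] /=.
  have [tr|rt] := ltP t r.
    have := Yr t; rewrite t0 tT => /(_ isT); apply: cvg_trans.
    apply: near_eq_cvg; near=> s; rewrite min_r//; apply/ltW.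
    by near: s; exact: nbhs_right_lt.
  apply: cvg_near_cst; near=> s; rewrite min_l//.
  by apply: (le_trans rt); apply/ltW; near: s; exact: nbhs_right_gt.
have [tr|rt] := leP t r.
  have := Yl t; rewrite t0 tT => /(_ isT) /cvg_ex[l Yl'].
  apply/cvg_ex; exists l; move: Yl'; apply: cvg_trans.
  apply: near_eq_cvg; near=> s; rewrite min_r//; apply: le_trans tr; apply/ltW.
  by near: s; exact: nbhs_left_lt.
apply/cvg_ex; exists (Y r w); apply: cvg_near_cst; near=> s; rewrite min_l//.
by apply/ltW; near: s; exact: nbhs_left_gt.
Unshelve. all: by end_near. Qed.

Lemma adapted_simple_integral (phi : simple_integrand T F) Y :
  adapted T F Y -> adapted T F (simple_integral phi Y).
Proof.
move=> aY t /andP[t0 tT]; apply: measurable_sum => k.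
have [l0 lr rT] := @ends_ordered _ _ _ _ _ phi k.
have YF r : 0 <= r <= T -> measurable_wrt (F t) (Y (Num.min r t)).
  move=> /andP[r0 rT']; have m0 : 0 <= Num.min r t by rewrite le_min r0.
  have mt : Num.min r t <= t by rewrite ge_min lexx orbT.
  apply: (measurable_wrtS (filtration_mono m0 mt tT)); apply: aY.
  by rewrite m0 (le_trans mt).
have [tl|lt] := leP t (left_end k).
  (* before the left end the increment vanishes *)
  rewrite (_ : (fun _ => _) = cst 0); first exact: measurable_cst.
  by apply/funext => w; rewrite !min_r ?(le_trans tl)// subrr mulr0.
apply: measurable_funM.
  exact: (measurable_wrtS (filtration_mono l0 (ltW lt) tT)
    (@coef_measurable _ _ _ _ _ phi k)).
have rT0 : 0 <= right_end k <= T by rewrite rT (le_trans l0).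
have lT0 : 0 <= left_end k <= T by rewrite l0 (le_trans lr).
have mr := YF _ rT0; have := YF _ lT0; rewrite (min_l (ltW lt)) => ml.
by apply: measurable_funB; [exact: mr|exact: ml].
Qed.

Lemma cadlag_simple_integral (phi : simple_integrand T F) Y :
  cadlag T Y -> cadlag T (simple_integral phi Y).
Proof.
move=> cY; apply: cadlag_sum => k; apply: cadlagZ.
rewrite (_ : (fun _ _ => _) = (fun t w => Y (Num.min (right_end k) t) w
   + (fun=> -1) w * Y (Num.min (left_end k) t) w)).
  by apply: cadlagD; [|apply: cadlagZ]; exact: cadlag_stopped.
by apply/funext => t; apply/funext => w; rewrite mulN1r.
Qed.

Lemma simple_process_bounded (phi : simple_integrand T F) :
  exists C, forall t w, `|simple_process phi t w| <= C.
Proof.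
have [C0 C0P] := @coef0_bounded _ _ _ _ _ phi.
have /choice[C CP] := @coef_bounded _ _ _ _ _ phi.
have b01 (A : set R) t : `|\1_A t| <= 1 :> R.
  by rewrite indicE; case: (t \in A); rewrite ?normr1// normr0 ler01.
exists (C0 + \sum_k C k) => t w; apply: (le_trans (ler_normD _ _)); apply: lerD.
  rewrite normrM -[leRHS]mulr1 ler_pM//; exact: C0P.
apply: (le_trans (ler_norm_sum _ _ _)); apply: ler_sum => k _.
by rewrite normrM -[leRHS]mulr1 ler_pM//; exact: CP.
Qed.

(** The integrand chi carries both families of intervals, which may overlap. *)
Lemma simple_integrandD (phi psi : simple_integrand T F) :
  exists chi : simple_integrand T F,
    (forall t w, simple_process chi t w =
       simple_process phi t w + simple_process psi t w) /\
    (forall Y t w, simple_integral chi Y t w =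
       simple_integral phi Y t w + simple_integral psi Y t w).
Proof.
pose l (k : 'I_(pieces phi + pieces psi)) :=
  match fintype.split k with inl i => left_end i | inr j => left_end j end.
pose r (k : 'I_(pieces phi + pieces psi)) :=
  match fintype.split k with inl i => right_end i | inr j => right_end j end.
pose c (k : 'I_(pieces phi + pieces psi)) :=
  match fintype.split k with inl i => coef i | inr j => coef j end.
unshelve eexists (@SimpleIntegrand _ _ _ T F
  (fun w => Defs.coef0 phi w + Defs.coef0 psi w) (pieces phi + pieces psi) l r c _ _ _ _ _).
- by apply: measurable_funD; exact: coef0_measurable.
- have [C CP] := @coef0_bounded _ _ _ _ _ phi.
  have [D DP] := @coef0_bounded _ _ _ _ _ psi.
  exists (C + D) => w; apply: (le_trans (ler_normD _ _)); exact: lerD.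
- by move=> k; rewrite /l /r; case: fintype.split => i; exact: ends_ordered.
- by move=> k; rewrite /l /c; case: fintype.split => i; exact: coef_measurable.
- by move=> k; rewrite /c; case: fintype.split => i; exact: coef_bounded.
have lshiftE i : fintype.split (lshift (pieces psi) i) = inl i by exact: (unsplitK (inl _ i)).
have rshiftE i : fintype.split (rshift (pieces phi) i) = inr i by exact: (unsplitK (inr _ i)).
split=> [t w|Y t w].
  rewrite /simple_process/= big_split_ord/= mulrDl addrACA; congr ((_ + _) + (_ + _)).
    by apply: eq_bigr => i _; rewrite /l /r /c lshiftE.
  by apply: eq_bigr => i _; rewrite /l /r /c rshiftE.
rewrite /simple_integral/= big_split_ord/=; congr (_ + _).
  by apply: eq_bigr => i _; rewrite /l /r /c lshiftE.
by apply: eq_bigr => i _; rewrite /l /r /c rshiftE.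
Qed.

Lemma simple_integrandZ a (phi : simple_integrand T F) :
  exists chi : simple_integrand T F,
    (forall t w, simple_process chi t w = a * simple_process phi t w) /\
    (forall Y t w, simple_integral chi Y t w = a * simple_integral phi Y t w).
Proof.
unshelve eexists (@SimpleIntegrand _ _ _ T F (fun w => a * Defs.coef0 phi w)
  (pieces phi) (@left_end _ _ _ _ _ phi) (@right_end _ _ _ _ _ phi)
  (fun k w => a * coef k w) _ _ _ _ _).
- by apply: measurable_funM => //; exact: coef0_measurable.
- have [C CP] := @coef0_bounded _ _ _ _ _ phi.
  by exists (`|a| * C) => w; rewrite normrM ler_wpM2l.
- exact: ends_ordered.
- by move=> k; apply: measurable_funM => //; exact: coef_measurable.
- move=> k; have [C CP] := @coef_bounded _ _ _ _ _ phi k.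
  by exists (`|a| * C) => w; rewrite normrM ler_wpM2l.
split=> [t w|Y t w].
  rewrite /simple_process/= mulrDr mulrA mulr_sumr; congr (_ + _).
  by apply: eq_bigr => i _; rewrite mulrA.
by rewrite /simple_integral/= mulr_sumr; apply: eq_bigr => i _; rewrite mulrA.
Qed.

Lemma simple_integrand0 : exists chi : simple_integrand T F,
    (forall t w, simple_process chi t w = 0) /\
    (forall Y t w, simple_integral chi Y t w = 0).
Proof.
unshelve eexists (@SimpleIntegrand _ _ _ T F (cst 0) 0%N
  (fun=> 0) (fun=> 0) (fun=> cst 0) _ _ _ _ _).
- exact: measurable_cst.
- by exists 0 => w; rewrite normr0.
- by case.
- by case.
- by case.
split=> [t w|Y t w]; first by rewrite /simple_process/= big_ord0 mul0r addr0.
by rewrite /simple_integral/= big_ord0.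
Qed.

Section gains.
Variables (d : nat) (X : R -> Omega -> 'rV[R]_d).
Hypothesis X_semimartingale : semimartingale P T F X.

Lemma bounded_integral_regular H Y : bounded_integral P T F X H Y ->
  [/\ adapted T F Y, cadlag T Y &
      exists C, forall t w i, 0 <= t <= T -> `|H t w ord0 i| <= C].
Proof.
case=> [phi|Hn Yn {}H {}Y _ [C CP] Hlim aY cY _].
  split.
  - apply: adapted_sum => i; apply: adapted_simple_integral.
    by case: (X_semimartingale i).
  - apply: cadlag_sum => i; apply: cadlag_simple_integral.
    by case: (X_semimartingale i).
  - have /choice[C CP] i := simple_process_bounded (phi i).
    exists (\sum_i `|C i|) => t w i _; rewrite mxE (bigD1 i)//=.
    rewrite (le_trans (CP i t w))// (le_trans (ler_norm _))// lerDl.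
    exact: sumr_ge0.
split => //; exists C => t w i tT.
have /cvg_norm Hc := Hlim t w i tT.
have <- := cvg_lim (@norm_hausdorff _ _) Hc.
apply: limr_le; first by apply/cvg_ex; eexists; exact: Hc.
by apply: nearW => n; exact: CP.
Qed.

Lemma bounded_integralZ a H Y : 0 < a -> bounded_integral P T F X H Y ->
  bounded_integral P T F X (fun t w => a *: H t w) (fun t w => a * Y t w).
Proof.
move=> a0; elim=> [phi|Hn Yn {}H {}Y HYn IH [C CP] Hlim aY cY Ylim].
  have /choice[chi chiP] i := simple_integrandZ a (phi i).
  rewrite (_ : (fun t w => a *: _) = (fun t w => \row_i simple_process (chi i) t w)).
    rewrite (_ : (fun t w => a * _) =
        (fun t w => \sum_i simple_integral (chi i) (coordinate X i) t w)).
      exact: bounded_integral_simple.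
    apply/funext => t; apply/funext => w; rewrite mulr_sumr.
    by apply: eq_bigr => i _; rewrite (chiP i).2.
  apply/funext => t; apply/funext => w; apply/rowP => i.
  by rewrite !mxE (chiP i).1.
apply: (bounded_integral_lim IH).
- exists (a * C) => n t w i tT; rewrite mxE normrM gtr0_norm//.
  by rewrite ler_wpM2l ?(ltW a0)//; exact: CP.
- move=> t w i tT; rewrite mxE; under eq_fun do rewrite mxE.
  by apply: cvgM; [exact: cvg_cst|exact: Hlim].
- exact: adaptedZ.
- exact: (cadlagZ (cst a)).
- move=> t tT e e0.
  rewrite (_ : (fun n => P _) =
      (fun n => P [set w | e / a <= `|Yn n t w - Y t w|])).
    by apply: Ylim => //; exact: divr_gt0.
  apply/funext => n; congr (P _); apply/seteqP.
  by split=> w /=; rewrite -mulrBr normrM gtr0_norm// ler_pdivrMr// mulrC.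
Qed.

(** Two nested inductions.  A limit is taken in one summand while the other one
    is kept fixed, so the integrals converge in probability as before and the
    uniform bounds add up. *)
Lemma bounded_integralD H1 Y1 H2 Y2 :
  bounded_integral P T F X H1 Y1 -> bounded_integral P T F X H2 Y2 ->
  bounded_integral P T F X (fun t w => H1 t w + H2 t w)
    (fun t w => Y1 t w + Y2 t w).
Proof.
move=> HY1 HY2; have [aY1 cY1 [C1 C1P]] := bounded_integral_regular HY1.
elim: HY2 => {H2 Y2} [psi|Hn Yn H2 Y2 HYn IH [C CP] Hlim aY cY Ylim]; last first.
  apply: (bounded_integral_lim IH).
  - exists (C1 + C) => n t w i tT; rewrite mxE (le_trans (ler_normD _ _))//.
    by apply: lerD; [exact: C1P|exact: CP].
  - move=> t w i tT; rewrite mxE; under eq_fun do rewrite mxE.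
    by apply: cvgD; [exact: cvg_cst|exact: Hlim].
  - exact: adaptedD.
  - exact: cadlagD.
  - move=> t tT e e0.
    rewrite (_ : (fun n => P _) =
        (fun n => P [set w | e <= `|Yn n t w - Y2 t w|])).
      exact: Ylim.
    apply/funext => n; congr (P _); apply/seteqP.
    by split=> w /=; rewrite opprD addrACA subrr add0r.
have rpsi := bounded_integral_regular (bounded_integral_simple P X psi).
elim: HY1 {aY1 cY1 C1 C1P} => {H1 Y1} [phi|Hn Yn H1 Y1 HYn IH [C CP] Hlim aY cY Ylim].
  have /choice[chi chiP] i := simple_integrandD (phi i) (psi i).
  rewrite (_ : (fun t w => _ + \row__ _) =
      (fun t w => \row_i simple_process (chi i) t w)).
    rewrite (_ : (fun t w => _ + _) =
        (fun t w => \sum_i simple_integral (chi i) (coordinate X i) t w)).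
      exact: bounded_integral_simple.
    apply/funext => t; apply/funext => w; rewrite -big_split/=.
    by apply: eq_bigr => i _; rewrite (chiP i).2.
  apply/funext => t; apply/funext => w; apply/rowP => i.
  by rewrite !mxE (chiP i).1.
have [aY2 cY2 [C2 C2P]] := rpsi.
apply: (bounded_integral_lim IH).
- exists (C + C2) => n t w i tT; rewrite mxE (le_trans (ler_normD _ _))//.
  by apply: lerD; [exact: CP|exact: C2P].
- move=> t w i tT; rewrite mxE; under eq_fun do rewrite mxE.
  by apply: cvgD; [exact: Hlim|exact: cvg_cst].
- exact: adaptedD.
- exact: cadlagD.
- move=> t tT e e0.
  rewrite (_ : (fun n => P _) =
      (fun n => P [set w | e <= `|Yn n t w - Y1 t w|])).
    exact: Ylim.
  apply/funext => n; congr (P _); apply/seteqP.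
  by split=> w /=; rewrite opprD addrACA subrr addr0.
Qed.

(** Truncation at 1 is not homogeneous, whence the factors 1 + a and 1 + b: they
    are at least 1, which settles the case where u or v is truncated. *)
Lemma min1_linear_bound (a b u v x : R) : 0 <= a -> 0 <= b -> 0 <= u -> 0 <= v ->
  x <= a * u + b * v ->
  Num.min 1 x <= (1 + a) * Num.min 1 u + (1 + b) * Num.min 1 v.
Proof.
move=> a0 b0 u0 v0 xuv.
have m1 y : 0 <= y -> 0 <= Num.min 1 y :> R by move=> ?; rewrite le_min ler01.
have [u1|u1] := leP 1 u.
  rewrite mulr1; apply: (@le_trans _ _ 1); first by rewrite ge_min lexx.
  rewrite -[leLHS]addr0; apply: lerD; first by rewrite lerDl.
  by rewrite mulr_ge0 ?addr_ge0// m1.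
have [v1|v1] := leP 1 v.
  rewrite mulr1; apply: (@le_trans _ _ 1); first by rewrite ge_min lexx.
  by have : 0 <= (1 + a) * u by [rewrite mulr_ge0// addr_ge0]; lra.
by apply: (@le_trans _ _ x); [rewrite ge_min lexx orbT|lra].
Qed.

Lemma simple_integral_processD (phi : simple_integrand T F)
    (Y Z : R -> Omega -> R) t w :
  simple_integral phi (fun t w => Y t w + Z t w) t w =
  simple_integral phi Y t w + simple_integral phi Z t w.
Proof.
rewrite /simple_integral -big_split/=; apply: eq_bigr => k _.
by rewrite opprD addrACA mulrDr.
Qed.

Lemma simple_integral_processZ a (phi : simple_integrand T F)
    (Y : R -> Omega -> R) t w :
  simple_integral phi (fun t w => a * Y t w) t w = a * simple_integral phi Y t w.
Proof.
rewrite /simple_integral mulr_sumr; apply: eq_bigr => k _.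
by rewrite -mulrBr mulrCA.
Qed.

Let gap (D : R -> Omega -> R) (phi : simple_integrand T F) w : R :=
  Num.min 1 (`|D 0 w| + `|simple_integral phi D T w|).

Let gap_ge0 D phi w : 0 <= gap D phi w.
Proof. by rewrite le_min ler01 addr_ge0. Qed.

Let measurable_gap D phi : adapted T F D -> measurable_fun setT (gap D phi).
Proof.
move=> aD; apply: measurable_minr => //; apply: measurable_funD;
  apply: measurableT_comp => //.
- by apply: (adapted_measurable aD); rewrite lexx ltW.
- by apply: (adapted_measurable (adapted_simple_integral phi aD)); rewrite lexx ltW.
Qed.

(** The zero integrand shows that the supremum is not taken over the empty
    set. *)
Lemma emery_dist_ge0 Y Z : (0 <= emery_dist P T F Y Z)%E.
Proof.
have [chi [chi0 _]] := simple_integrand0.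
pose D t w := Y t w - Z t w.
apply: (@le_trans _ _ 'E_P[gap D chi]%E).
  by apply: expectation_ge0 => w; exact: gap_ge0.
by apply: ereal_sup_ubound; exists chi => // t w _; rewrite chi0 normr0.
Qed.

Lemma emery_dist_lin (a b : R) Y1 Z1 Y2 Z2 : 0 <= a -> 0 <= b ->
  adapted T F Y1 -> adapted T F Z1 -> adapted T F Y2 -> adapted T F Z2 ->
  (emery_dist P T F (fun t w => a * Y1 t w + b * Y2 t w)%R
     (fun t w => a * Z1 t w + b * Z2 t w)%R <=
   (1 + a)%:E * emery_dist P T F Y1 Z1 + (1 + b)%:E * emery_dist P T F Y2 Z2)%E.
Proof.
move=> a0 b0 aY1 aZ1 aY2 aZ2; apply: ge_ereal_sup => _ [phi phi1 <-].
pose D1 t w := Y1 t w - Z1 t w; pose D2 t w := Y2 t w - Z2 t w.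
have aB (U V : R -> Omega -> R) : adapted T F U -> adapted T F V ->
    adapted T F (fun t w => U t w - V t w).
  move=> aU aV; rewrite (_ : (fun _ _ => _) = (fun t w => U t w + -1 * V t w)).
    by apply: adaptedD => //; exact: adaptedZ.
  by apply/funext => t; apply/funext => w; rewrite mulN1r.
have aD1 : adapted T F D1 by exact: aB.
have aD2 : adapted T F D2 by exact: aB.
have DE : (fun t w => a * Y1 t w + b * Y2 t w - (a * Z1 t w + b * Z2 t w)) =
    (fun t w => a * D1 t w + b * D2 t w).
  by apply/funext => t; apply/funext => w; rewrite /D1 /D2; ring.
have sup_ge U V : ('E_P[gap (fun t w => (U t w - V t w)%R) phi] <= emery_dist P T F U V)%E.
  by apply: ereal_sup_ubound; exists phi.
apply: (@le_trans _ _ ((1 + a)%:E * 'E_P[gap D1 phi] + (1 + b)%:E * 'E_P[gap D2 phi])%E);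
  last first.
  by apply: leeD; apply: lee_wpmul2l; rewrite ?lee_fin ?addr_ge0//; exact: sup_ge.
have D0 := fun D aD => @measurable_gap D phi aD.
rewrite unlock -!ge0_integralZl//; last 6 first.
- exact/measurable_EFinP/D0.
- by move=> w _; rewrite lee_fin.
- by rewrite lee_fin addr_ge0.
- exact/measurable_EFinP/D0.
- by move=> w _; rewrite lee_fin.
- by rewrite lee_fin addr_ge0.
rewrite -ge0_integralD//; last 4 first.
- by move=> w _; rewrite -EFinM lee_fin mulr_ge0// addr_ge0.
- by apply/measurable_EFinP; apply: measurable_funM => //; exact: D0.
- by move=> w _; rewrite -EFinM lee_fin mulr_ge0// addr_ge0.
- by apply/measurable_EFinP; apply: measurable_funM => //; exact: D0.
apply: ge0_le_integral => //.
- apply/measurable_EFinP; rewrite -/(gap _ _) DE; apply: D0.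
  by apply: adaptedD; exact: adaptedZ.
- apply/measurable_EFinP; apply: measurable_funD; apply: measurable_funM => //; exact: D0.
move=> w _; rewrite -!EFinM -EFinD lee_fin.
rewrite -/(gap _ _ w) DE /gap simple_integral_processD !simple_integral_processZ.
have /= n1 := ler_normD (a * D1 0 w) (b * D2 0 w).
have /= n2 := ler_normD (a * simple_integral phi D1 T w) (b * simple_integral phi D2 T w).
move: n1 n2; rewrite !normrM (ger0_norm a0) (ger0_norm b0).
move=> n1 n2; apply: min1_linear_bound => //; try exact: addr_ge0.
by apply: (le_trans (lerD n1 n2)); rewrite le_eqVlt; apply/orP; left; apply/eqP; ring.
Qed.

Lemma emery_dist_lin_cvg (a b : R) Yn1 Y1 Yn2 Y2 : 0 <= a -> 0 <= b ->
  (forall n, adapted T F (Yn1 n)) -> adapted T F Y1 ->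
  (forall n, adapted T F (Yn2 n)) -> adapted T F Y2 ->
  emery_dist P T F (Yn1 n) Y1 @[n --> \oo] --> 0%E ->
  emery_dist P T F (Yn2 n) Y2 @[n --> \oo] --> 0%E ->
  emery_dist P T F (fun t w => a * Yn1 n t w + b * Yn2 n t w)
    (fun t w => a * Y1 t w + b * Y2 t w) @[n --> \oo] --> 0%E.
Proof.
move=> a0 b0 aYn1 aY1 aYn2 aY2 c1 c2.
apply: (@squeeze_cvge _ _ _ _ (cst 0%E) _ (fun n =>
  (1 + a)%:E * emery_dist P T F (Yn1 n) Y1 +
  (1 + b)%:E * emery_dist P T F (Yn2 n) Y2)%E).
- apply: nearW => n; rewrite emery_dist_ge0/=.
  exact: emery_dist_lin.
- exact: cvg_cst.
- rewrite -[X in _ --> X](_ : ((1 + a)%:E * 0 + (1 + b)%:E * 0 = 0)%E); last first.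
    by rewrite !mule0 adde0.
  apply: cvgeD; [by rewrite !mule0|exact: cvgeZl|exact: cvgeZl].
Qed.

Lemma stochastic_integral_lin (a b : R) H1 Y1 H2 Y2 : 0 < a -> 0 < b ->
  stochastic_integral P T F X H1 Y1 -> stochastic_integral P T F X H2 Y2 ->
  stochastic_integral P T F X (fun t w => a *: H1 t w + b *: H2 t w)
    (fun t w => a * Y1 t w + b * Y2 t w).
Proof.
move=> a0 b0 [aY1 cY1 [Hn1 [Yn1 [B1 L1' E1]]]] [aY2 cY2 [Hn2 [Yn2 [B2 L2' E2]]]].
split.
- by apply: adaptedD; exact: adaptedZ.
- by apply: cadlagD; [exact: (cadlagZ (cst a))|exact: (cadlagZ (cst b))].
exists (fun n t w => a *: Hn1 n t w + b *: Hn2 n t w),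
  (fun n t w => a * Yn1 n t w + b * Yn2 n t w); split.
- by move=> n; apply: bounded_integralD; exact: bounded_integralZ.
- move=> t w i tT; rewrite !mxE; under eq_fun do rewrite !mxE.
  apply: cvgD; (apply: cvgM; first exact: cvg_cst); [exact: L1'|exact: L2'].
- apply: emery_dist_lin_cvg => //; first [exact: ltW|idtac].
  + by move=> n; have [] := bounded_integral_regular (B1 n).
  + by move=> n; have [] := bounded_integral_regular (B2 n).
Qed.

Lemma terminal_gains_lin (a b : R) g h : 0 < a -> 0 < b ->
  terminal_gains P T F X g -> terminal_gains P T F X h ->
  terminal_gains P T F X (fun w => a * g w + b * h w).
Proof.
move=> a0 b0 [mg [H1 [Y1 [[pH1 sY1 [c1 c1P]] gY1]]]].
move=> [mh [H2 [Y2 [[pH2 sY2 [c2 c2P]] hY2]]]].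
split; first by apply: measurable_funD; exact: measurable_funM.
exists (fun t w => a *: H1 t w + b *: H2 t w), (fun t w => a * Y1 t w + b * Y2 t w).
split; last by apply: filterS2 gY1 hY2 => w -> ->.
split.
- move=> i.
  rewrite (_ : (fun z => _) = (fun z => a * H1 z.1 z.2 ord0 i + b * H2 z.1 z.2 ord0 i)).
    by apply: measurable_funD; apply: measurable_funM.
  by apply/funext => z; rewrite !mxE.
- exact: stochastic_integral_lin.
- exists (a * c1 + b * c2) => t tT; apply: filterS2 (c1P t tT) (c2P t tT) => w h1 h2.
  by rewrite opprD -!mulrN lerD// ler_wpM2l// ltW.
Qed.

Lemma terminal_gains0 : terminal_gains P T F X (fun=> 0).
Proof.
have [chi [chi0 chii0]] := simple_integrand0.
have B0 : bounded_integral P T F X (fun _ _ => 0) (fun _ _ => 0).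
  rewrite (_ : (fun _ _ => 0 : 'rV[R]_d) = (fun t w => \row__ simple_process chi t w)).
    rewrite (_ : (fun _ _ => 0 : R) =
        (fun t w => \sum_i simple_integral chi (coordinate X i) t w)).
      exact: (bounded_integral_simple P X (fun=> chi)).
    by apply/funext => t; apply/funext => w; rewrite big1.
  by apply/funext => t; apply/funext => w; apply/rowP => i; rewrite !mxE chi0.
have [a0 c0 _] := bounded_integral_regular B0.
split; first exact: measurable_cst.
exists (fun _ _ => 0), (fun _ _ => 0); split; last exact: aeW.
split.
- move=> i; rewrite (_ : (fun z => _) = cst 0); first exact: measurable_cst.
  by apply/funext => z; rewrite mxE.
- split => //; exists (fun=> fun _ _ => 0), (fun=> fun _ _ => 0); split => //.
    by move=> t w i _; rewrite mxE; exact: cvg_cst.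
  have D0 : emery_dist P T F (fun _ _ => 0) (fun _ _ => 0) = 0%E.
    apply/eqP; rewrite eq_le emery_dist_ge0 andbT.
    apply: ge_ereal_sup => _ [phi _ <-].
    rewrite (_ : (fun w => _) = cst 0) ?expectation_cst//; apply/funext => w.
    rewrite /simple_integral big1 => [|k _]; last by rewrite !subrr mulr0.
    by rewrite subrr normr0 addr0 min_r.
  by rewrite D0; exact: cvg_cst.
- by exists 0 => t _; apply: aeW => w; rewrite oppr0.
Qed.


End gains.

End stochastic_cone.

(** * Duality *)

Lemma dominates_ae d (T : measurableType d) (R : realType)
    (mu nu : {measure set T -> \bar R}) (p : T -> Prop) :
  nu `<< mu -> {ae mu, forall x, p x} -> {ae nu, forall x, p x}.
Proof.
move=> /null_content_dominatesP numu [N [mN N0 Np]].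
by exists N; split => //; exact: numu.
Qed.

Section duality.
Context {R : realType} {disp : measure_display} {Omega : measurableType disp}.
Variables (P : probability Omega R) (T : R) (F : R -> set (set Omega)).
Variables (d : nat) (X : R -> Omega -> 'rV[R]_d) (f : Omega -> R).
Hypotheses (T_gt0 : 0 < T) (F_usual : usual_filtration P T F)
  (X_semimartingale : semimartingale P T F X).
Local Notation K := (terminal_gains P T F X).

Lemma terminal_gains_lbound g : K g -> exists c : R, {ae P, forall w, - c <= g w}.
Proof.
move=> [mg [H [Y [[_ _ [c cP]] gY]]]]; exists c.
have TT : 0 <= T <= T by rewrite lexx ltW.
by apply: filterS2 gY (cP _ TT) => w ->.
Qed.

Lemma superreplication_expectation (Q : probability Omega R) x :
  M1 P T F X Q -> L1 Q f ->
  L1_closure Q (gains_minus_L1_nonneg P T F X Q) (fun w => f w - x) ->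
  ('E_Q[f] <= x%:E)%E.
Proof.
move=> [_ KL1 KE] fL1 [_ clos]; apply/lee_addgt0Pr => e e0.
have [a [g Kg [h [hL1 h0] <-]] lt_e] := clos e e0.
have gL1 := KL1 _ Kg.
have i1 u : L1 Q u -> Q.-integrable setT (EFin \o u) by move=> /Lfun1_integrable.
have iu : Q.-integrable setT (EFin \o (fun w => f w - x - (g w - h w))).
  rewrite (_ : _ \o _ = ((EFin \o f) \- (EFin \o cst x)) \-
      ((EFin \o g) \- (EFin \o h)))%E//.
  apply: integrableB => //; apply: integrableB => //; try exact: i1.
  exact: finite_measure_integrable_cst.
have [if_ ig ih] : [/\ Q.-integrable setT (EFin \o f),
    Q.-integrable setT (EFin \o g) & Q.-integrable setT (EFin \o h)].
  by split; exact: i1.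
have ix : Q.-integrable setT (EFin \o cst x) by exact: finite_measure_integrable_cst.
have h_ge0 : 0 <= \int[Q]_w h w.
  have mh : measurable_fun setT h by apply/measurable_EFinP/(measurable_int _ ih).
  have hh : {ae Q, forall w, `|h w| = h w} by apply: filterS h0 => w; exact: ger0_norm.
  have [_ E] := ae_eq_integrable mh hh (integrable_norm ih).
  by rewrite /Rintegral E -/(Rintegral _ _ _) Rintegral_ge0.
have g_le0 : \int[Q]_w g w <= 0.
  have := KE _ Kg; rewrite unlock -lee_fin fineK//.
  exact: (integrable_fin_num measurableT ig).
have uE : \int[Q]_w (f w - x - (g w - h w)) =
    \int[Q]_w f w - x - (\int[Q]_w g w - \int[Q]_w h w).
  have ifx : Q.-integrable setT (EFin \o (fun w => f w - x)) by exact: (integrableB _ if_ ix).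
  have igh : Q.-integrable setT (EFin \o (fun w => g w - h w)) by exact: (integrableB _ ig ih).
  rewrite RintegralB// (RintegralB measurableT if_ ix) RintegralB//.
  rewrite Rintegral_cst//; congr (_ - _ - _).
  by rewrite -[RHS]mulr1; congr (_ * _); apply: (congr1 fine (_ : _ = 1%E)); exact: probability_setT.
have u_lt : \int[Q]_w (f w - x - (g w - h w)) < e.
  apply: le_lt_trans (ler_norm _) _; apply: (le_lt_trans (le_normr_Rintegral measurableT iu)).
  rewrite -lte_fin fineK; last exact: (integrable_fin_num measurableT (integrable_norm iu)).
  by move: lt_e; rewrite Lnorm1.
rewrite unlock -[leLHS]fineK; last exact: (integrable_fin_num measurableT if_).
rewrite -EFinD lee_fin -/(Rintegral _ _ _).
by move: u_lt; rewrite uE; lra.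
Qed.

(** If f - x were not in the closure, the separating density would define a
    member Q1 of M1 with E_Q1[f - x] > 0. *)
Lemma superreplication_of_expectation_bound (Q : probability Omega R) x :
  (\bigcap_(Q' in M1 P T F X) L1 Q') f ->
  M1 P T F X Q ->
  (forall Q', M1 P T F X Q' -> ('E_Q'[f] <= x%:E)%E) ->
  L1_closure Q (gains_minus_L1_nonneg P T F X Q) (fun w => f w - x).
Proof.
move=> fL1 MQ Ef; have [QP KL1 KE] := MQ; apply: contrapT => far.
have phiL1 : L1 Q (fun w => f w - x).
  apply/Lfun1_integrable.
  rewrite (_ : _ \o _ = ((EFin \o f) \- (EFin \o cst x))%E)//.
  apply: integrableB => //; last exact: finite_measure_integrable_cst.
  by apply/Lfun1_integrable; exact: fL1.
have [|||rho [mrho rho0 rho1 rhoK [iphi phi_gt0]]] :=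
    exists_separating_density (terminal_gains0 F_usual X_semimartingale)
      _ _ KL1 _ phiL1 far.
- move=> g h Kg Kh.
  have := terminal_gains_lin T_gt0 F_usual X_semimartingale ltr01 ltr01 Kg Kh.
  by congr (terminal_gains P T F X); apply/funext => w; rewrite !mul1r.
- move=> a g a0 Kg.
  have := terminal_gains_lin T_gt0 F_usual X_semimartingale a0 a0 Kg
    (terminal_gains0 F_usual X_semimartingale).
  by congr (terminal_gains P T F X); apply/funext => w; rewrite mulr0 addr0.
- move=> g /terminal_gains_lbound[c gc]; exists c; exact: dominates_ae gc.
have [Q1 [Q1Q Q1E]] := exists_density mrho rho0 rho1.
have MQ1 : M1 P T F X Q1.
  have Kint g : K g -> Q1.-integrable setT (EFin \o g) /\ (\int[Q1]_w (g w)%:E <= 0)%E.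
    move=> Kg; have [ig g_le0] := rhoK _ Kg.
    have [|i E] := Q1E g _ ig; first by case: Kg.
    by rewrite E.
  split.
  - exact: null_dominates_trans QP.
  - by move=> g /Kint[ig _]; exact/Lfun1_integrable.
  - by move=> g /Kint[_]; rewrite unlock.
have [|i1 E1] := Q1E (fun w => f w - x) _ iphi.
  by apply/measurable_EFinP; have /Lfun1_integrable/measurable_int := phiL1.
have := Ef _ MQ1; rewrite unlock leNgt => /negP; apply.
have if1 : Q1.-integrable setT (EFin \o f) by apply/Lfun1_integrable; exact: fL1.
move: phi_gt0; rewrite -E1; under eq_integral do rewrite EFinB.
rewrite integralB//; last exact: finite_measure_integrable_cst.
rewrite integral_cst//= (_ : Q1 setT = 1%E) ?mule1 ?sube_gt0//.
exact: probability_setT.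
Qed.

End duality.

Theorem corollary4 (R : realType) (disp : measure_display)
    (Omega : measurableType disp) (P : probability Omega R) (T : R)
    (F : R -> set (set Omega)) (d : nat) (X : R -> Omega -> 'rV[R]_d)
    (f : Omega -> R)
    (T_gt0 : 0 < T)
    (F_usual : usual_filtration P T F)
    (X_semimartingale : semimartingale P T F X)
    (f_measurable : measurable_fun [set: Omega] f)
    (M1_equiv : M1 P T F X `&` equivalent_probabilities P !=set0)
    (f_L1 : (\bigcap_(Q in M1 P T F X) L1 Q) f) :
  f_id P T F X f = ereal_sup [set 'E_Q[f]%E | Q in M1 P T F X].
Proof.
apply/eqP; rewrite eq_le; apply/andP; split; last first.
  apply: ge_ereal_sup => _ [Q MQ <-]; apply: le_ereal_inf_tmp => _ [x xf <-].
  by apply: superreplication_expectation => //; [exact: MQ|exact: f_L1|exact: xf].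
set S := ereal_sup _.
have SE Q : M1 P T F X Q -> ('E_Q[f] <= S)%E.
  by move=> MQ; apply: ereal_sup_ubound; exists Q.
(* A finite supremum is itself a superreplication price; it is not -oo since
   M1 has a member, under which f is integrable. *)
case: S SE => [x| |] SE; [|exact: leey|].
  apply: ereal_inf_lbound; exists x => //= Q MQ.
  exact: superreplication_of_expectation_bound.
have [Q [MQ _]] := M1_equiv.
have := expectation_fin_num (f_L1 _ MQ).
by have := SE _ MQ; rewrite leeNy_eq => /eqP ->.
Qed.
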